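(* Let $G$ be an infinite residually finite countable group. The following statements are equivalent: (1) $G$ is amenable. (2) Every almost automorphic topological dynamical system $(X,G)$ has invariant probability measures. (3) Every almost automorphic topological dynamical system $(X,G)$ whose maximal equicontinuous factor is a Cantor system has invariant probability measures. (4) Every Toeplitz $G$-subshift has invariant probability measures. (5) There exists a minimal equicontinuous Cantor system $(Z,G)$ with a free orbit such that every symbolic almost one-to-one extension of $(Z,G)$ has invariant probability measures.
   Context: A topological dynamical system $(X,G)$ is a non-empty compact metric space $X$ with a continuous action of a countable discrete group $G$; it is minimal if every orbit is dense, equicontinuous if the family of maps $x\mapsto gx$, $g\in G$, is uniformly equicontinuous, and it has a free orbit if some point has trivial stabilizer. It is a Cantor system if $X$ is a Cantor set (non-empty, compact, metric, totally disconnected, without isolated points). A factor map $\pi:X\to Y$ is a continuous surjective equivariant map; then $(X,G)$ is an extension of $(Y,G)$. It is almost one-to-one if $\{y\in Y:|\pi^{-1}\{y\}|=1\}$ is dense in $Y$. The maximal equicontinuous factor of $(X,G)$ is the factor, unique up to conjugacy, that is equicontinuous and through which every factor map from $(X,G)$ to an equicontinuous system passes. $(X,G)$ is almost automorphic if its maximal equicontinuous factor is minimal and the associated factor map is almost one-to-one. ''Has invariant probability measures'' means there is at least one $G$-invariant Borel probability measure on the phase space. For a finite alphabet $\Sigma$ (with at least two elements), $G$ acts on $\Sigma^G$ (product topology) by the shift $(hx)(g)=x(h^{-1}g)$; a $G$-subshift is a closed $G$-invariant subset of $\Sigma^G$ with the restricted action. A symbolic almost one-to-one extension of $(Z,G)$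 is a $G$-subshift that is an extension of $(Z,G)$ through an almost one-to-one factor map. An element $x\in\Sigma^G$ is Toeplitz if for every $g\in G$ there is a finite index subgroup $\Gamma$ of $G$ such that $x(g)=x(\gamma^{-1}g)$ for all $\gamma\in\Gamma$. A Toeplitz $G$-subshift is the orbit closure of a Toeplitz element. *)

(* Defs.v *)
From HB Require Import structures.
From mathcomp Require Import all_boot all_order all_algebra.
From mathcomp Require Import all_classical all_reals all_analysis.

Set Implicit Arguments.
Unset Strict Implicit.
Unset Printing Implicit Defensive.

Import Order.TTheory GRing.Theory Num.Theory.
Import numFieldTopology.Exports.

Local Open Scope classical_set_scope.
Local Open Scope ring_scope.

Section groups.
Context (G : groupType).

Definition subgroup (H : set G) : Prop := group_closed (mem H).

Definition finite_index_subgroup (H : set G) : Prop :=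
  subgroup H /\ finite_set [set [set (g * h)%g | h in H] | g in [set: G]].

Definition residually_finite : Prop :=
  forall g : G, g != 1%g -> exists2 H, finite_index_subgroup H & ~ H g.

(* Von Neumann's definition of amenability of a discrete group: invariance and
   additivity are required for all subsets of [G], and additivity only finitely. *)
Definition invariant_mean (R : realType) (m : set G -> R) : Prop :=
  [/\ forall A, 0 <= m A,
      m [set: G] = 1,
      forall A B, A `&` B = set0 -> m (A `|` B) = m A + m B
    & forall g A, m [set (g * h)%g | h in A] = m A].

Definition amenable (R : realType) : Prop :=
  exists m : set G -> R, invariant_mean m.

End groups.

Record gaction (G : groupType) (X : topologicalType) := GAction {
  act :> G -> X -> X;
  act_one : forall x, act 1%g x = x;
  act_mul : forall g h x, act (g * h)%g x = act g (act h x);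
  act_continuous : forall g, continuous (act g) }.

Definition gorbit (G : groupType) (X : topologicalType) (a : gaction G X)
    (x : X) : set X := [set a g x | g in [set: G]].

Section maps.
Context (G : groupType) (X Y : topologicalType).

Definition factor_map (a : gaction G X) (b : gaction G Y) (f : X -> Y) : Prop :=
  [/\ continuous f,
      forall y, exists x, f x = y
    & forall g x, f (a g x) = b g (f x)].

Definition almost_one_to_one (f : X -> Y) : Prop :=
  dense [set y | exists x, f @^-1` [set y] = [set x]].

End maps.

(* The library's measurable types are pointed, topological spaces are not: the
   Borel structure is taken on a copy of the space in which an arbitrary point
   has been singled out.  The sigma-algebra does not depend on this point. *)
Definition pointed_at (X : Type) (x0 : X) : Type := X.

HB.instance Definition _ (X : choiceType) (x0 : X) :=
  Choice.on (pointed_at x0).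
HB.instance Definition _ (X : choiceType) (x0 : X) :=
  isPointed.Build (pointed_at x0) x0.

Notation borel x0 :=
  (g_sigma_algebraType (@open _ : set (set (pointed_at x0)))).

Definition has_invariant_probability (R : realType) (G : groupType)
    (X : topologicalType) (a : gaction G X) : Prop :=
  exists (x0 : X) (mu : probability (borel x0) R),
    forall g (A : set (borel x0)), measurable A ->
      mu (a g @^-1` A : set (borel x0)) = mu A.

Record tds (R : realType) (G : groupType) := TDS {
  phase :> metricType R;
  tact : gaction G phase;
  phase_neq0 : [set: phase] !=set0;
  phase_compact : compact [set: phase] }.

Section tds.
Context (R : realType) (G : groupType).

Definition minimal_tds (X : tds R G) : Prop :=
  forall x, dense (gorbit (tact X) x).

Definition equicontinuous_tds (X : tds R G) : Prop :=
  forall e : R, 0 < e -> exists2 d : R, 0 < d &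
    forall g (x y : X), mdist x y < d -> mdist (tact X g x) (tact X g y) < e.

Definition has_free_orbit (X : tds R G) : Prop :=
  exists x, forall g, tact X g x = x -> g = 1%g.

(* Non-emptiness and compactness are part of [tds]. *)
Definition cantor_system (X : tds R G) : Prop :=
  totally_disconnected [set: X] /\ isolated [set: X] = set0.

Definition max_equicontinuous_factor (X Y : tds R G) (p : X -> Y) : Prop :=
  [/\ factor_map (tact X) (tact Y) p,
      equicontinuous_tds Y
    & forall (W : tds R G) (q : X -> W),
        equicontinuous_tds W -> factor_map (tact X) (tact W) q ->
        exists2 r : Y -> W, factor_map (tact Y) (tact W) r & q = r \o p].

Definition almost_automorphic (X : tds R G) : Prop :=
  exists (Y : tds R G) (p : X -> Y),
    [/\ max_equicontinuous_factor p, minimal_tds Y & almost_one_to_one p].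

End tds.

Lemma continuous_prod_topology (I : eqType) (K : I -> topologicalType)
    (X : topologicalType) (f : X -> prod_topology K) :
  (forall i, continuous (fun x => f x i)) -> continuous f.
Proof.
move=> fC x; apply/(@cvg_sup (forall i, K i) I) => i U [_ [[W oW <-] Wx WU]].
apply: (filterS WU).
exact: (fC i x W (open_nbhs_nbhs (conj oW Wx))).
Qed.

Section symbolic.
Context (G : groupType) (S : finType).

Definition full_shift : topologicalType := {ptws G -> discrete_topology S}.

Definition shift (h : G) (x : full_shift) : full_shift :=
  fun g => x (h^-1 * g)%g.

Lemma shift1 x : shift 1%g x = x.
Proof. by apply/funext => g; rewrite /shift invg1 mul1g. Qed.

Lemma shiftM g h x : shift (g * h)%g x = shift g (shift h x).
Proof. by apply/funext => k; rewrite /shift invgM mulgA. Qed.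

Lemma shift_continuous h : continuous (shift h).
Proof.
apply: (@continuous_prod_topology G (fun=> discrete_topology S)) => i.
exact: (@proj_continuous G (fun=> discrete_topology S) (h^-1 * i)%g).
Qed.

Definition full_shift_action : gaction G full_shift :=
  GAction shift1 shiftM shift_continuous.

Record subshift := Subshift {
  points :> set full_shift;
  subshift_closed : closed points;
  subshift_invariant : forall g x, points x -> points (shift g x) }.

Section restriction.
Context (X : subshift).

Lemma subshift_mem g (x : set_type X) : shift g (set_val x) \in (X : set _).
Proof. exact/mem_set/subshift_invariant/set_valP. Qed.

Definition sub_shift (g : G) (x : set_type X) : set_type X :=
  exist _ (shift g (set_val x)) (subshift_mem g x).

Lemma sub_shift1 x : sub_shift 1%g x = x.
Proof. by apply: val_inj; rewrite /= shift1. Qed.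

Lemma sub_shiftM g h x :
  sub_shift (g * h)%g x = sub_shift g (sub_shift h x).
Proof. by apply: val_inj; rewrite /= shiftM. Qed.

Lemma sub_shift_continuous g : continuous (sub_shift g).
Proof.
apply: continuous_comp_initial => x.
apply: (@continuous_comp _ _ _ (set_val : X -> full_shift) (shift g)).
  exact: initial_continuous.
exact: shift_continuous.
Qed.

Definition subshift_action : gaction G (set_type X) :=
  GAction sub_shift1 sub_shiftM sub_shift_continuous.

End restriction.

Definition toeplitz (x : full_shift) : Prop :=
  forall g, exists2 H : set G, finite_index_subgroup H &
    forall h, H h -> x g = x (h^-1 * g)%g.

Definition toeplitz_subshift (X : subshift) : Prop :=
  exists2 x, toeplitz x & (X : set _) = closure (gorbit full_shift_action x).

End symbolic.

(* Main.v *)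
(* Left to right, an invariant mean transported to an orbit is regularised to a
   Borel measure.  Conversely, if [G] is not amenable then, by Hahn-Banach, [G]
   carries a bounded flow, along finitely many right translations, of divergence
   at least 1.  Such flows form a convex set, so interpolating with slowly
   varying cutoffs makes the flow periodic, at one more element after the other,
   along the return times to ever smaller neighbourhoods of a point with a free
   orbit of an equicontinuous Cantor system [Z].  Values that are already periodic
   are unchanged by interpolation, and the divergence stays at least 1/2.
   Rounded to finitely many values and paired with a coding of [Z], the limit flow
   generates a subshift which is an almost one-to-one extension of [Z] and on which
   a positive function has zero integral for every invariant measure.
   An almost one-to-one extension of a minimal equicontinuous system has it
   as maximal equicontinuous factor, and over an odometer the singleton
   fibres consist of Toeplitz elements. *)
Require Import Defs.
From HB Require Import structures.
From mathcomp Require Import all_boot all_order all_algebra.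
From mathcomp Require Import all_classical all_reals all_analysis.
From mathcomp Require Import measurable_realfun.
From mathcomp Require Import lra zify.

Set Implicit Arguments.
Unset Strict Implicit.
Unset Printing Implicit Defensive.

Import Order.TTheory GRing.Theory Num.Theory.
Import numFieldTopology.Exports.

Local Open Scope classical_set_scope.
Local Open Scope ring_scope.

(** * Toeplitz flows *)

(** Flows run along right translations, whereas the shift, and with it periodicity, concerns left
    translations. The two commute, so a finite patch of a flow can be copied to left translates
    without harm to the divergence inside; only the rim of a copy is at risk. There the error is the
    variation of the cutoff times a bound on the flow. It has to be small at each point, not on
    average, so suitable cutoffs exist on every group, amenable or not. Flows stay real-valued until
    the end because convex combinations are needed; the divergence left over pays for the rounding.

    The coding of $Z$ meets another obstacle: an infinite equicontinuous system is never expansive,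
    so the orbit of a locally constant function with finitely many values cannot separate its
    points. The coding is therefore given one discontinuity, placed off the orbit of the free point.
    Condition (5) supplies an arbitrary $Z$, not presented by finite index subgroups, whence the use
    of invariant clopen relations. *)

Section subgroups.
Context (G : groupType) (H : set G).
Hypothesis sgH : subgroup H.

Lemma subgroup1 : H 1%g.
Proof. by have [/set_mem] := sgH. Qed.

Lemma subgroupV g : H g -> H g^-1%g.
Proof. by move=> /mem_set /(group_closedV sgH) /set_mem. Qed.

Lemma subgroupM g h : H g -> H h -> H (g * h)%g.
Proof. by move=> /mem_set Hg /mem_set Hh; exact/set_mem/(group_closedM sgH). Qed.

End subgroups.

(** The comparison of layer counts behind [cutoff]: a translation by [s i] or its inverse moves an
    element at most one layer outwards, so the counts at neighbours differ by at most one. *)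
Lemma sum_shift_le (a b : nat -> bool) L : (forall j, a j -> b j.+1) ->
  (\sum_(j < L) a j <= (\sum_(j < L) b j).+1)%N.
Proof.
move=> ab; apply: (@leq_trans (\sum_(j < L.+1) b j)).
  rewrite big_ord_recl; apply: leq_trans (leq_addl _ _).
  by apply: leq_sum => j _; case aj: (a j) => //; rewrite ab.
by rewrite big_ord_recr /= -addn1 leq_add2l leq_b1.
Qed.

(** Applied to the quotients [b * b'^-1] of a finite set [B], this makes the translates of [B] by
    [Gam n] pairwise disjoint. *)
Lemma avoid_finite (G : groupType) (Gam : nat -> set G) (P : set G) (N : nat) :
  (forall m n, (m <= n)%N -> Gam n `<=` Gam m) ->
  (forall g, (forall n, Gam n g) -> g = 1%g) ->
  finite_set P -> ~ P 1%g ->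
  exists2 n, (N <= n)%N & forall p, P p -> ~ Gam n p.
Proof.
move=> Gdec G1 /finite_seqP[r ->] /=; elim: r => [|p r IH] /= rN1; first by exists N.
have [|n nN nr] := IH; first by move=> r1; apply: rN1; rewrite inE r1 orbT.
have [m mp] : exists m, ~ Gam m p.
  apply: contrapT => /forallNP Gp; apply: rN1; rewrite inE (G1 p) ?eqxx // => k.
  by apply: contrapT; exact: Gp.
exists (maxn n m); first by rewrite leq_max nN.
move=> q; rewrite inE => /orP[/eqP ->|/nr nq] /Gdec; first by move/(_ _ (leq_maxr _ _)).
by move/(_ _ (leq_maxl _ _)).
Qed.

Section flows.
Context (R : realType) (G : groupType) (I : finType) (s : I -> G).

(** Read [x i g] as the amount sent from [g] to [g * (s i)^-1]: this is outflow minus inflow at [g].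
    It commutes with left translations. *)
Definition divergence (x : I -> G -> R) (g : G) : R :=
  \sum_i (x i g - x i (g * s i)%g).

(** Let [Ds j] be the [j]-th neighbourhood of [D] in the graph with edges from [g] to [g * s i].
    Then [chi g] is the proportion of the [L] first layers that contain [g], and it changes by at
    most [1/L] along an edge. The set [B = Ds L] has one layer to spare, which takes in the
    neighbours of the support. *)
Lemma cutoff (D : set G) (e : R) : finite_set D -> 0 < e ->
  exists (B : set G) (chi : G -> R),
    [/\ finite_set B, forall g, 0 <= chi g <= 1, forall g, D g -> chi g = 1,
        forall g, (chi g != 0 -> B g) /\ (forall i, chi (g * s i)%g != 0 -> B g)
      & forall g i, `|chi g - chi (g * s i)%g| <= e].
Proof.
move=> finD e0.
pose nb (A : set G) := A `|` \bigcup_(i in [set: I])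
  ([set (a * s i)%g | a in A] `|` [set (a * (s i)^-1)%g | a in A]).
pose Ds j := iter j nb D.
have nbA A : A `<=` nb A by move=> a; left.
have nbs A g i : A g -> nb A (g * s i)%g.
  by move=> Ag; right; exists i => //; left; exists g.
have nbV A g i : A (g * s i)%g -> nb A g.
  by move=> Ag; right; exists i => //; right; exists (g * s i)%g; rewrite ?mulgK.
have DsD j g : D g -> Ds j g by move=> Dg; elim: j => //= j IH; exact: nbA.
have DsS j k g : (j <= k)%N -> Ds j g -> Ds k g.
  by move=> /subnKC <-; elim: (k - j)%N => [|m IH] ?; rewrite ?addn0 ?addnS //=;
    apply: nbA; exact: IH.
have finDs j : finite_set (Ds j).
  elim: j => //= j IH; rewrite finite_setU; split => //.
  apply: bigcup_finite => // i _; rewrite finite_setU.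
  by split; exact: finite_image.
pose L := (Num.truncn e^-1).+1.
have L0 : (0 : R) < L%:R by rewrite ltr0n.
have Le : L%:R^-1 <= e.
  by rewrite invf_ple ?posrE // ltW // truncnS_gt.
pose c g := (\sum_(j < L) `[< Ds j g >])%N.
exists (Ds L), (fun g => (c g)%:R / L%:R); split => //.
- move=> g; rewrite divr_ge0 //= ler_pdivrMr // mul1r ler_nat.
  apply: (@leq_trans (\sum_(j < L) 1)%N); last by rewrite sum1_card card_ord.
  by apply: leq_sum => j _; exact: leq_b1.
- move=> g Dg; rewrite (_ : c g = L) ?divff ?gt_eqF //.
  rewrite /c (eq_bigr (fun=> 1%N)) ?sum1_card ?card_ord // => j _.
  by rewrite asboolT //; exact: DsD.
- have cN0 g : (c g)%:R / L%:R != 0 :> R -> exists2 j, (j < L)%N & Ds j g.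
    move=> cg; apply: contrapT => nex; move: cg; rewrite /c big1 ?mul0r ?eqxx //.
    by move=> j _; rewrite asboolF // => Dj; apply: nex; exists j.
  move=> g; split => [|i] /cN0 [j jL Dj]; first by apply: DsS Dj; exact: ltnW.
  by apply: (DsS j.+1) => //; exact: nbV Dj.
- move=> g i; rewrite -mulrBl normrM (ger0_norm (_ : 0 <= L%:R^-1)) ?invr_ge0 //.
  apply: le_trans Le; rewrite ler_piMl ?invr_ge0 // ler_norml.
  have c1 : (c g <= (c (g * s i)%g).+1)%N.
    apply: (@sum_shift_le (fun j => `[< Ds j g >])
      (fun j => `[< Ds j (g * s i)%g >])) => j /asboolP Dg.
    by apply/asboolP; exact: nbs.
  have c2 : (c (g * s i)%g <= (c g).+1)%N.
    apply: (@sum_shift_le (fun j => `[< Ds j (g * s i)%g >])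
      (fun j => `[< Ds j g >])) => j /asboolP Dg.
    by apply/asboolP; exact: nbV Dg.
  move: c1 c2; rewrite -!(ler_nat R) -!natr1 => ? ?; lra.
Qed.

(* A point where [x] is already periodic is not moved: there [x'] is a convex
   combination of equal values. *)
Lemma periodic_step (Gam : nat -> set G) (x : I -> G -> R) (K c e : R)
    (D : set G) (N : nat) :
  (forall n, subgroup (Gam n)) ->
  (forall g, (forall n, Gam n g) -> g = 1%g) ->
  (forall m n, (m <= n)%N -> Gam n `<=` Gam m) ->
  finite_set D -> 0 < e ->
  (forall i g, `|x i g| <= K) ->
  (forall g, c <= divergence x g) ->
  exists (n : nat) (x' : I -> G -> R),
    [/\ (N <= n)%N, forall i g, `|x' i g| <= K,
        forall g, c - e <= divergence x' g,
        forall i g h, D g -> Gam n h -> x' i (h * g)%g = x i g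
      & forall i g, (forall h, Gam n h -> x i (h * g)%g = x i g) ->
          x' i g = x i g].
Proof.
move=> Gsg G1 Gdec finD e0 xK xc.
(* An edge costs at most [e / M * (2 * K)] of divergence, which sums over [I] to at most [e]; the
   summand 1 keeps [M] positive. *)
pose M := 1 + (2 * K) * #|I|%:R.
(* A negative bound leaves no index in [I], and then [x] itself will do. *)
have [K0|K0] := boolP (0 <= K); last first.
  have noI (i : I) : False.
    by move: K0; rewrite -ltNge => /(le_lt_trans (xK i 1%g)); rewrite normr_lt0.
  exists N, x; split => [//|i|g|i|i]; try by have := noI i.
  by rewrite lerBlDr (le_trans (xc g)) // lerDl ltW.
have M0 : 0 < M.
  by rewrite /M ltr_wpDr // mulr_ge0 // mulr_ge0.
have [B [chi [finB chi01 chiD chiB chi_e]]] := cutoff finD (divr_gt0 e0 M0).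
(* For this [n], each [g] lies in at most one translate of [B] by an element of [Gam n]. *)
have [n nN nB] : exists2 n, (N <= n)%N &
    forall b b', B b -> B b' -> Gam n (b * b'^-1)%g -> b = b'.
  pose P := [set (b.1 * b.2^-1)%g | b in B `*` B] `\ 1%g.
  have finP : finite_set P by apply/finite_setD/finite_image/finite_setX.
  have [|n nN nP] := avoid_finite N Gdec G1 finP; first by case=> _; apply.
  exists n => // b b' Bb Bb' Gb; apply: contrapT => bb'.
  apply: (nP (b * b'^-1)%g) => //; split; first by exists (b, b').
  by move=> /= b1; apply: bb'; apply: (mulIg b'^-1%g); rewrite b1 mulgV.
pose P g h := Gam n h /\ B (h^-1 * g)%g.
have Puniq g h h' : P g h -> P g h' -> h = h'.
  move=> [Gh Bh] [Gh' Bh']; apply/invg_inj/(mulIg g)/nB => //.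
  rewrite invgM mulgA mulgK invgK.
  by apply: subgroupM => //; exact: subgroupV.
(* [x'] blends [x] with its restriction to [B], carried over to the translate of [B] through [g].
   The default of [xget] is harmless: the test fails when no translate contains [g]. *)
pose x' i g := let h := xget 1%g [set h | P g h] in
  if `[< P g h >] then x i g + chi (h^-1 * g)%g * (x i (h^-1 * g)%g - x i g)
  else x i g.
(* Here [h] need only be the sole candidate with non-zero cutoff at [g], so that one [h] can serve
   [g] and all its neighbours. *)
have x'E i g h : Gam n h ->
    (forall h', Gam n h' -> chi (h'^-1 * g)%g != 0 -> h' = h) ->
    x' i g = x i g + chi (h^-1 * g)%g * (x i (h^-1 * g)%g - x i g).
  move=> Gh hu; rewrite /x'; case: asboolP => [Pg|nP].
    have [chi0|chi0] := eqVneq (chi (h^-1 * g)%g) 0; last first.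
      by rewrite (Puniq _ _ h Pg) //; split => //; apply: (chiB _).1.
    have [->|/(hu _ Pg.1) -> //] :=
      eqVneq (chi ((xget 1%g [set h | P g h])^-1 * g)%g) 0.
    by rewrite chi0 !mul0r.
  have [->|chi0] := eqVneq (chi (h^-1 * g)%g) 0; first by rewrite mul0r addr0.
  exfalso; apply: nP; apply: (@xgetI _ 1%g [set h | P g h] h).
  by split => //; apply: (chiB _).1.
have hE g : exists2 h, Gam n h & forall h', Gam n h' -> B (h'^-1 * g)%g -> h' = h.
  have [[h Pgh]|nP] := pselect (exists h, P g h).
    by exists h; [exact: Pgh.1 | move=> h' Gh' Bh'; apply: (Puniq g)].
  by exists 1%g; [exact: subgroup1 | move=> h' Gh' Bh'; case: nP; exists h'].
exists n, x'; split => //.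
- move=> i g; have [h Gh hu] := hE g.
  rewrite (x'E i g h) //; last by move=> h' Gh' chi0; apply: hu => //; apply: (chiB _).1.
  have := xK i g; have := xK i (h^-1 * g)%g; have := chi01 (h^-1 * g)%g.
  rewrite !ler_norml => /andP[? ?] /andP[? ?] /andP[? ?]; nra.
- move=> g; have [h Gh hu] := hE g.
  pose t := chi (h^-1 * g)%g; pose ti i := chi (h^-1 * (g * s i))%g.
  pose D1 i := x i g - x i (g * s i)%g.
  pose D2 i := x i (h^-1 * g)%g - x i (h^-1 * g * s i)%g.
  (* Discrete product rule: the difference is the convex combination of [D1 i] and [D2 i], plus the
     variation of the cutoff times a difference of two values of [x]. *)
  have dE i : (1 - t) * D1 i + t * D2 i - e / M * (2 * K) <=
      x' i g - x' i (g * s i)%g.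
    rewrite (x'E i g h) //; last first.
      by move=> h' Gh' chi0; apply: hu => //; apply: (chiB _).1.
    rewrite (x'E i (g * s i)%g h) //; last first.
      by move=> h' Gh'; rewrite mulgA => chi0; apply: hu => //; apply: (chiB _).2 chi0.
    rewrite /D1 /D2 -/t !mulgA; set a := x i g; set a' := x i (g * s i)%g.
    set b := x i (h^-1 * g)%g; set b' := x i (h^-1 * g * s i)%g.
    set t' := chi (h^-1 * g * s i)%g.
    have tt : `|(t - t') * (b' - a')| <= e / M * (2 * K).
      rewrite normrM ler_pM //; first exact: chi_e.
      by rewrite (le_trans (ler_normB _ _)) // mulr_natl mulr2n lerD // xK.
    by move: tt; rewrite ler_norml => /andP[tt _]; lra.
  apply: le_trans (ler_sum _ (fun i _ => dE i)).
  rewrite sumrB big_split /= -!mulr_sumr sumr_const.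
  have h1 : c <= \sum_i D1 i by exact: xc.
  have h2 : c <= \sum_i D2 i by exact: xc.
  have eM : (e / M * (2 * K)) *+ #|I| <= e.
    rewrite -mulr_natr -mulrA mulrAC ler_pdivrMr // ler_pM2l // /M.
    by rewrite lerDr.
  have /andP[t0 t1] := chi01 (h^-1 * g)%g.
  rewrite lerB //; rewrite -/t in t0 t1; nra.
- move=> i g h Dg Gh; have Bg : B g by apply: (chiB _).1; rewrite chiD // oner_eq0.
  rewrite (x'E i (h * g)%g h) //.
    by rewrite mulKg chiD // mul1r addrC subrK.
  move=> h' Gh' chi0; apply: (Puniq (h * g)%g); last by split => //; rewrite mulKg.
  by split => //; apply: (chiB _).1.
- move=> i g per; have [h Gh hu] := hE g.
  rewrite (x'E i g h) //; last by move=> h' Gh' chi0; apply: hu => //; apply: (chiB _).1.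
  by rewrite per ?subrr ?mulr0 ?addr0 //; exact: subgroupV.
Qed.

(* Starting from any bounded flow, [periodic_step] makes it periodic at one
   more element of [G] at each stage; the values already fixed survive. *)
Lemma toeplitz_flow (Gam : nat -> set G) (x : I -> G -> R) (K : R) :
  countable [set: G] ->
  (forall n, subgroup (Gam n)) ->
  (forall g, (forall n, Gam n g) -> g = 1%g) ->
  (forall m n, (m <= n)%N -> Gam n `<=` Gam m) ->
  (forall i g, `|x i g| <= K) ->
  (forall g, 1 <= divergence x g) ->
  exists y : I -> G -> R,
    [/\ forall i g, `|y i g| <= K, forall g, 2^-1 <= divergence y g
      & forall g, exists n, forall i h, Gam n h -> y i (h * g)%g = y i g].
Proof.
move=> /countable_injP[code /in2TT codeI] Gsg G1 Gdec xK xdiv.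
pose D k := [set g | (code g <= k)%N].
have finD k : finite_set (D k).
  rewrite (_ : D k = code @^-1` `I_k.+1) //.
  by apply: finite_preimage; [move=> ? ? _ _; exact: codeI | exact: finite_II].
(* [c 0 = 1] is the given divergence; stage [k] may lose [2^-(k+2)], so that it never falls below
   [1/2]. *)
pose c k : R := 2^-1 + 2^-1 ^+ k.+1.
pose good k (st : nat * (I -> G -> R)) :=
  (forall i g, `|st.2 i g| <= K) /\ (forall g, c k <= divergence st.2 g).
pose next k (st st' : nat * (I -> G -> R)) :=
  [/\ (st.1 <= st'.1)%N,
      forall i g h, D k g -> Gam st'.1 h -> st'.2 i (h * g)%g = st.2 i g
    & forall i g, (forall h, Gam st'.1 h -> st.2 i (h * g)%g = st.2 i g) ->
          st'.2 i g = st.2 i g].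
have /choice[F FP] : forall kst : nat * (nat * (I -> G -> R)), exists st',
    good kst.1 kst.2 -> good kst.1.+1 st' /\ next kst.1 kst.2 st'.
  move=> [k st]; have [/= [stK stc]|] := pselect (good k st); last by exists st.
  have e0 : (0 : R) < 2^-1 ^+ k.+2 by rewrite exprn_gt0 // invr_gt0.
  have [n [x' [? ? xc ? ?]]] := periodic_step st.1 Gsg G1 Gdec (finD k) e0 stK stc.
  exists (n, x') => _; split; last by split.
  split => //= g; apply: le_trans (xc g); rewrite /c [2^-1 ^+ k.+1]exprS [2^-1 ^+ k.+2]exprS.
  rewrite [2^-1 ^+ k.+1]exprS; lra.
pose st := fix st n := if n is m.+1 then F (m, st m) else (0%N, x).
have goodst k : good k (st k).
  elim: k => [|k IH]; last by have [] := FP (k, st k) IH.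
  split => // g; apply: le_trans (xdiv g); rewrite /c expr1; lra.
have nextst k : next k (st k) (st k.+1) by have [] := FP (k, st k) (goodst k).
pose y i g := (st (code g).+1).2 i g.
have Gst m k : (m <= k)%N -> Gam (st k).1 `<=` Gam (st m).1.
  move=> /subnKC <-; apply: Gdec.
  elim: (k - m)%N => [|j IH]; rewrite ?addn0 // addnS.
  by apply: leq_trans IH _; have [] := nextst (m + j)%N.
(* Once the flow is constant on a coset of a return subgroup through [g], it is periodic there under
   all later, smaller subgroups, and the later stages leave the coset alone. *)
have per g k : (code g < k)%N ->
    forall i h, Gam (st (code g).+1).1 h -> (st k).2 i (h * g)%g = y i g.
  move=> /subnKC <-; elim: (k - _)%N => [|j IH] i h Gh.
    have [_ perD _] := nextst (code g).
    have Dg : D (code g) g by exact: leqnn.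
    rewrite addn0 perD // /y -(perD i g 1%g) ?mul1g //; exact: subgroup1.
  rewrite addnS; have [_ _ ->] := nextst ((code g).+1 + j)%N; first exact: IH.
  move=> h' Gh'; rewrite mulgA !IH //; apply: subgroupM => //.
  by apply: Gst Gh'; rewrite -addnS leq_addr.
have yE g k : (code g < k)%N -> forall i, (st k).2 i g = y i g.
  by move=> kg i; rewrite -(per g k kg i 1%g) ?mul1g //; exact: subgroup1.
exists y; split.
- by move=> i g; have [+ _] := goodst (code g).+1; exact.
- move=> g; pose k := (maxn (code g) (\max_i code (g * s i)%g)).+1.
  have -> : divergence y g = divergence (st k).2 g.
    apply: eq_bigr => i _; rewrite !yE // ltnS ?leq_maxl //.
    by rewrite leq_max (leq_bigmax i) orbT.
  have [_ /(_ g)] := goodst k; apply: le_trans.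
  by rewrite /c lerDl exprn_ge0.
- move=> g; exists (st (code g).+1).1 => i h Gh.
  pose k := (maxn (code g) (code (h * g)%g)).+1.
  by rewrite -(yE (h * g)%g k) ?ltnS ?leq_maxr // per // ltnS leq_maxl.
Qed.

End flows.

(** * Non-amenability produces a flow *)

Section hahn_banach.
Context (R : realType) (V : lmodType R) (B : set V).
Hypotheses (BD : forall v w, B v -> B w -> B (v + w))
  (BZ : forall (a : R) v, B v -> B (a *: v)).

(** The conditions bear on the subspace [B] only, so that bounded functions need no type of their
    own. Homogeneity is an inequality; applied to the inverse scalar it gives the equality. *)
Definition sublinear_on (p : V -> R) : Prop :=
  (forall v w, B v -> B w -> p (v + w) <= p v + p w) /\
  (forall (a : R) v, 0 < a -> B v -> p (a *: v) <= a * p v).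

Let sublinear_opp p v : sublinear_on p -> B v -> - p (- v) <= p v.
Proof.
move=> [pD pZ] Bv; have BN : B (- v) by rewrite -scaleN1r; exact: BZ.
have B0 : B 0 by rewrite -(scale0r v); exact: BZ.
have := pD _ _ Bv BN; have := pZ 2 _ (ltr0n _ 2) B0; rewrite subrr scaler0; lra.
Qed.

(* A minimal sublinear functional below [P] is additive: lowering it along the
   direction [v] cannot change it. *)
Lemma exists_additive_le (P : V -> R) : sublinear_on P ->
  exists phi : V -> R, (forall v, B v -> phi v <= P v) /\
    (forall v w, B v -> B w -> phi (v + w) = phi v + phi w).
Proof.
move=> subP.
pose T := {p : V -> R | sublinear_on p /\ forall v, B v -> p v <= P v}.
(* The order is reversed, so that a maximal element for Zorn's lemma is a minimal functional. It is
   only a preorder, since values outside [B] do not count. *)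
pose below (p q : T) : bool := `[< forall v, B v -> sval q v <= sval p v >].
have TP : sublinear_on P /\ forall v, B v -> P v <= P v by [].
have lowT (p : T) v : B v -> - P (- v) <= sval p v.
  case: p => p /= [subp pP] Bv; apply: le_trans (sublinear_opp subp Bv).
  by rewrite lerN2 pP // -scaleN1r; exact: BZ.
have [] := @ZL_preorder T (exist _ P TP) below.
- by move=> p; apply/asboolP.
- move=> q p r /asboolP pq /asboolP qr; apply/asboolP => v Bv.
  by rewrite (le_trans (qr v Bv)) ?pq.
- move=> A totA; have [->|/set0P[a Aa]] := eqVneq A set0; first by exists (exist _ P TP).
  pose E v := [set sval p v | p in A].
  have E0 v : E v !=set0 by exists (sval a v), a.
  have Elb v : B v -> has_lbound (E v).
    by move=> Bv; exists (- P (- v)) => _ [p _ <-]; exact: lowT.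
  have qle p v : A p -> B v -> inf (E v) <= sval p v.
    by move=> Ap Bv; apply: ge_inf; [exact: Elb | exists p].
  have subq : sublinear_on (fun v => inf (E v)).
    split => [v w Bv Bw|c v c0 Bv].
      rewrite -lerBlDr; apply: lb_le_inf => // _ [p1 Ap1 <-].
      rewrite lerBlDr -lerBlDl; apply: lb_le_inf => // _ [p2 Ap2 <-].
      rewrite lerBlDl.
      have [/asboolP p12|/asboolP p21] := totA _ _ Ap1 Ap2.
        apply: le_trans (qle _ _ Ap2 (BD Bv Bw)) _.
        have [[pD _] _] := svalP p2; rewrite (le_trans (pD _ _ Bv Bw)) // lerD2r.
        exact: p12.
      apply: le_trans (qle _ _ Ap1 (BD Bv Bw)) _.
      have [[pD _] _] := svalP p1; rewrite (le_trans (pD _ _ Bv Bw)) // lerD2l.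
      exact: p21.
    rewrite -ler_pdivrMl //; apply: lb_le_inf => // _ [p Ap <-].
    rewrite ler_pdivrMl //; apply: le_trans (qle _ _ Ap (BZ c Bv)) _.
    by have [[_ pZ] _] := svalP p; exact: pZ.
  have qP v : B v -> inf (E v) <= P v.
    by move=> Bv; rewrite (le_trans (qle a v _ _)) //; have [_] := svalP a; exact.
  exists (exist _ (fun v => inf (E v)) (conj subq qP)) => p Ap.
  by apply/asboolP => v Bv /=; exact: qle.
move=> [p [subp pP]] pmin; exists p; split => // v w Bv Bw.
apply/eqP; rewrite eq_le; have [pD pZ] := subp; rewrite pD //=.
(* The infimum of [E u] is again sublinear in [u] and at most [p u], hence equal to it on [B] by
   minimality. The parameter [t = 1] at [u = w] then gives [p w + p v <= p (w + v)]. *)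
pose E u := [set p (u + t *: v) - t * p v | t in [set t : R | 0 <= t]].
have pv t : 0 <= t -> t * p v <= p (t *: v).
  rewrite le_eqVlt => /predU1P[<-|t0].
    rewrite mul0r scale0r; have B0 : B 0 by rewrite -(scale0r v); exact: BZ.
    by have := pZ 2 _ (ltr0n _ 2) B0; rewrite scaler0; lra.
  rewrite -ler_pdivlMl //; have := pZ t^-1 _ _ (BZ t Bv).
  by rewrite scalerA mulVf ?gt_eqF // scale1r invr_gt0; exact.
have E0 u : E u !=set0 by exists (p (u + 0 *: v) - 0 * p v), 0 => //=.
have Elb u : B u -> has_lbound (E u).
  move=> Bu; exists (- p (- u)) => _ [t /= t0 <-].
  have BN : B (- u) by rewrite -scaleN1r; exact: BZ.
  have := pD (u + t *: v) (- u) (BD Bu (BZ t Bv)) BN.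
  by rewrite addrAC subrr add0r; have := pv t t0; lra.
have qle u t : B u -> 0 <= t -> inf (E u) <= p (u + t *: v) - t * p v.
  by move=> Bu t0; apply: ge_inf; [exact: Elb | exists t].
have qp u : B u -> inf (E u) <= p u.
  by move=> Bu; have := qle u 0 Bu (lexx _); rewrite scale0r addr0 mul0r subr0.
have subq : sublinear_on (fun u => inf (E u)).
  split => [u1 u2 Bu1 Bu2|c u c0 Bu].
    rewrite -lerBlDr; apply: lb_le_inf => // _ [t1 /= t10 <-].
    rewrite lerBlDr -lerBlDl; apply: lb_le_inf => // _ [t2 /= t20 <-].
    rewrite lerBlDl; apply: le_trans (qle _ (t1 + t2) (BD Bu1 Bu2) _) _.
      exact: addr_ge0.
    have := pD _ _ (BD Bu1 (BZ t1 Bv)) (BD Bu2 (BZ t2 Bv)).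
    by rewrite scalerDl addrACA; lra.
  rewrite -ler_pdivrMl //; apply: lb_le_inf => // _ [t /= t0 <-].
  rewrite ler_pdivrMl //; apply: le_trans (qle _ (c * t) (BZ c Bu) _) _.
    by rewrite mulr_ge0 // ltW.
  have := pZ c _ c0 (BD Bu (BZ t Bv)); rewrite scalerDr scalerA.
  by rewrite mulrBr mulrA lerD2r.
have qP u : B u -> inf (E u) <= P u by move=> Bu; rewrite (le_trans (qp u Bu)) ?pP.
have /asboolP/(_ w Bw) /= := pmin (exist _ _ (conj subq qP))
  (asboolT (fun u Bu => qp u Bu)).
by have := qle w 1 Bw ler01; rewrite scale1r mul1r [w + v]addrC; lra.
Qed.

End hahn_banach.

(** If no such flow exists, the infimum over all flows of the upper bounds of [f] plus a divergence
    is a sublinear functional of bounded [f]. An additive functional below it vanishes on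
    divergences and is at most the supremum of [f], so it yields an invariant mean. *)
Lemma amenableP (R : realType) (G : groupType) : ~ amenable G R ->
  exists (I : finType) (s : I -> G) (x : I -> G -> R) (K : R),
    (forall i g, `|x i g| <= K) /\ (forall g, 1 <= divergence s x g).
Proof.
move=> namen; apply: contrapT => noflow; apply: namen.
(* The index set is left free: flows are added by joining their index sets. *)
pose flow (h : G -> R) := exists (I : finType) (s : I -> G) (x : I -> G -> R) (K : R),
  (forall i g, `|x i g| <= K) /\ h = divergence s x.
have flow_pos h (c : R) : flow h -> 0 < c -> ~ forall g, c <= h g.
  move=> [I [s [x [K [xK ->]]]]] c0 hc; apply: noflow.
  exists I, s, (fun i g => c^-1 * x i g), (c^-1 * K); split => [i g|g].
    by rewrite normrM gtr0_norm ?invr_gt0 // ler_pM2l ?invr_gt0.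
  rewrite /divergence -(mulVf (lt0r_neq0 c0)).
  by under eq_bigr do rewrite -mulrBr; rewrite -mulr_sumr ler_pM2l ?invr_gt0 ?hc.
have flowD h1 h2 : flow h1 -> flow h2 -> flow (h1 + h2).
  move=> [I1 [s1 [x1 [K1 [xK1 ->]]]]] [I2 [s2 [x2 [K2 [xK2 ->]]]]].
  exists (I1 + I2)%type, (fun i => match i with inl i => s1 i | inr i => s2 i end).
  exists (fun i => match i with inl i => x1 i | inr i => x2 i end), (Num.max K1 K2).
  split => [[i|i] g|]; rewrite ?le_max ?xK1 ?xK2 ?orbT //.
  by apply/funext => g; rewrite /divergence big_sumType.
have flowZ c h : flow h -> flow (c *: h).
  move=> [I [s [x [K [xK ->]]]]]; exists I, s, (fun i g => c * x i g), (`|c| * K).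
  split => [i g|]; first by rewrite normrM ler_wpM2l.
  apply/funext => g; rewrite scalrfctE /divergence scaler_sumr.
  by apply: eq_bigr => i _; rewrite scalerBr.
have flow1 (f : G -> R) s (K : R) : (forall g, `|f g| <= K) ->
    flow (fun g => f g - f (g * s)%g).
  move=> fK; exists 'I_1, (fun=> s), (fun=> f), K; split => //.
  by apply/funext => g; rewrite /divergence big_ord1.
have flow0 : flow 0.
  have -> : (0 : G -> R) = (fun g : G => 0 - 0) by apply/funext => g; rewrite subrr.
  by apply: (flow1 (fun=> 0) 1%g 0) => g; rewrite normr0.
pose V : lmodType R := G -> R.
pose B := [set f : V | exists K : R, forall g, `|f g| <= K].
have BD f h : B f -> B h -> B (f + h).
  move=> [K fK] [L hL]; exists (K + L) => g.
  by rewrite (le_trans (ler_normD _ _)) // lerD.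
have BZ (a : R) f : B f -> B (a *: f).
  by move=> [K fK]; exists (`|a| * K) => g; rewrite normrM ler_wpM2l.
pose E (f : V) := [set c : R | exists2 h, flow h & forall g, f g + h g <= c].
(* The absence of a flow is used here: a smaller upper bound would make some divergence uniformly
   positive. *)
have Elb (f : V) (K : R) : (forall g, `|f g| <= K) -> lbound (E f) (- K).
  move=> fK c [h fh hc]; rewrite leNgt; apply/negP => cK.
  apply: (@flow_pos (- h) (- K - c)); [by rewrite -scaleN1r; exact: flowZ | by rewrite subr_gt0|].
  move=> g; rewrite opprfctE.
  by have := fK g; rewrite ler_norml => /andP[? _]; have := hc g; lra.
have E0 f : B f -> E f !=set0.
  move=> [K fK]; exists K, 0 => // g; rewrite /= addr0.
  by have := fK g; rewrite ler_norml => /andP[_].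
have Ele f c : B f -> E f c -> inf (E f) <= c.
  by move=> [K fK] Ec; apply: ge_inf => //; exists (- K); exact: Elb.
have subE : sublinear_on B (fun f => inf (E f)).
  split => [f h Bf Bh|a f a0 Bf].
    rewrite -lerBlDr; apply: lb_le_inf; first exact: E0.
    move=> c1 [h1 fh1 c1P]; rewrite lerBlDr -lerBlDl; apply: lb_le_inf; first exact: E0.
    move=> c2 [h2 fh2 c2P]; rewrite lerBlDl; apply: Ele; first exact: BD.
    exists (h1 + h2); first exact: flowD.
    by move=> g; have := c1P g; have := c2P g; rewrite !addrfctE; lra.
  rewrite -ler_pdivrMl //; apply: lb_le_inf; first exact: E0.
  move=> c [h fh cP]; rewrite ler_pdivrMl //; apply: Ele; first exact: BZ.
  exists (a *: h); first exact: flowZ.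
  move=> g; rewrite !scalrfctE -scalerDr; exact: ler_wpM2l (ltW a0) _ _ (cP g).
have [phi [phile phiD]] := exists_additive_le BD BZ subE.
have phi_le f h c : B f -> flow h -> (forall g, f g + h g <= c) -> phi f <= c.
  by move=> Bf fh fc; rewrite (le_trans (phile _ Bf)) // Ele //; exists h.
have phi_le0 f c : B f -> (forall g, f g <= c) -> phi f <= c.
  by move=> Bf fc; apply: (phi_le f 0) => // g; rewrite addr0.
have BN f : B f -> B (- f) by move=> Bf; rewrite -scaleN1r; exact: BZ.
have phi0 : phi 0 = 0.
  have B0 : B 0 by exists 0 => g; rewrite normr0.
  by have := phiD 0 0 B0 B0; rewrite addr0; lra.
have phiN f : B f -> phi (- f) = - phi f.
  by move=> Bf; have := phiD _ _ Bf (BN _ Bf); rewrite subrr phi0; lra.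
(* The inverse turns the right translations of flows into the left translations of the mean. *)
pose ind (A : set G) : V := fun g => (`[< A g^-1%g >] : nat)%:R.
have ind01 A g : 0 <= ind A g <= 1 by rewrite /ind; case: asboolP => _; rewrite ?lexx ?ler01.
have Bind A : B (ind A).
  by exists 1 => g; have /andP[? ?] := ind01 A g; rewrite ger0_norm.
exists (fun A => phi (ind A)); split.
- move=> A; rewrite -oppr_le0 -phiN //; apply: phi_le0; first exact: BN.
  by move=> g; rewrite oppr_le0; have /andP[] := ind01 A g.
- have ind1 g : ind setT g = 1 by rewrite /ind asboolT.
  apply/eqP; rewrite eq_le phi_le0 //=; last by move=> g; rewrite ind1.
  rewrite -lerN2 -phiN //; apply: phi_le0; first exact: BN.
  by move=> g; rewrite opprfctE ind1.
- move=> A A' AA'; rewrite -phiD //; congr phi; apply/funext => g.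
  rewrite addrfctE /ind -natrD; congr (_%:R); rewrite asbool_or.
  case: asboolP => Ag; case: asboolP => A'g //=.
  by have : (A `&` A') g^-1%g by []; rewrite AA'.
- move=> s A; have indE g : ind [set (s * h)%g | h in A] g = ind A (g * s)%g.
    rewrite /ind; congr (nat_of_bool _)%:R; apply: asbool_equiv_eq.
    rewrite invgM; split => [[h Ah <-]|As]; first by rewrite mulKg.
    by exists (s^-1 * g^-1)%g => //; rewrite mulVKg.
  have fi : flow (fun g => ind A g - ind A (g * s)%g).
    by apply: (flow1 _ _ 1) => g; have /andP[? ?] := ind01 A g; rewrite ger0_norm.
  apply/eqP; rewrite eq_le -subr_le0 -phiN // -phiD //; last exact: BN.
  apply/andP; split.
    apply: (phi_le _ _ _ _ fi); first by apply: BD => //; exact: BN.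
    by move=> g; rewrite !addrfctE opprfctE indE; lra.
  rewrite -subr_le0 -phiN // -phiD //; last exact: BN.
  apply: (phi_le _ _ _ _ (flowZ (-1) _ fi)); first by apply: BD => //; exact: BN.
  move=> g; rewrite !addrfctE scaleN1r !opprfctE indE; lra.
Qed.

(** Adding [K] makes the values non-negative. Scaling by [N = 2 * (#|I| + 1)] turns divergence [1/2]
    into [#|I| + 1], while rounding down costs at most 1 per index, so an integer divergence of at
    least 1 remains. *)
Lemma toeplitz_nat_flow (R : realType) (G : groupType) (Gam : nat -> set G) :
  ~ amenable G R ->
  countable [set: G] ->
  (forall n, subgroup (Gam n)) ->
  (forall g, (forall n, Gam n g) -> g = 1%g) ->
  (forall m n, (m <= n)%N -> Gam n `<=` Gam m) ->
  exists (I : finType) (s : I -> G) (J : nat) (x : I -> G -> 'I_J.+1),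
    (forall g, (\sum_i x i (g * s i)%g < \sum_i x i g)%N) /\
    (forall g, exists n, forall i h, Gam n h -> x i (h * g)%g = x i g).
Proof.
move=> /amenableP[I [s [x0 [K [x0K x0div]]]]] cG Gsg G1 Gdec.
have [x [xK xdiv xper]] := toeplitz_flow cG Gsg G1 Gdec x0K x0div.
pose N : R := (#|I|.+1 * 2)%:R.
have N0 : 0 <= N by rewrite ler0n.
pose q i g := Num.truncn ((x i g + K) * N).
have x0' i g : 0 <= (x i g + K) * N.
  have := xK i g; rewrite ler_norml => /andP[? _].
  by rewrite mulr_ge0 //; lra.
have qle i g : (q i g)%:R <= (x i g + K) * N by rewrite /q truncn_le.
have qgt i g : (x i g + K) * N < (q i g)%:R + 1 by rewrite natr1 truncnS_gt.
pose J := Num.truncn ((K + K) * N).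
have qJ i g : (q i g < J.+1)%N.
  rewrite ltnS; apply: le_truncn; rewrite ler_wpM2r // lerD2r.
  by have := xK i g; rewrite ler_norml => /andP[].
exists I, s, J, (fun i g => inord (q i g)); split => [g|g]; last first.
  by have [n xn] := xper g; exists n => i h Gh; rewrite /q xn.
under eq_bigr do rewrite inordK //; under [ltnRHS]eq_bigr do rewrite inordK //.
rewrite -(ltr_nat R) !natr_sum -subr_gt0 -sumrB.
have step i : (x i g - x i (g * s i)%g) * N - 1 <= (q i g)%:R - (q i (g * s i)%g)%:R.
  have := qle i (g * s i)%g; have := qgt i g; rewrite !mulrDl; lra.
apply: lt_le_trans (ler_sum _ (fun i _ => step i)).
rewrite sumrB -mulr_suml sumr_const -/(divergence s x g).
have := ler_wpM2r N0 (xdiv g); rewrite {1}/N natrM mulrC mulfK ?pnatr_eq0 // -natr1; lra.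
Qed.

(** * Invariant measures from invariant means *)

Section regular_content.
Context (R : realType) (X : topologicalType) (nu : set X -> R).
Hypotheses (nu_ge0 : forall A, 0 <= nu A) (nuT : nu [set: X] = 1)
  (nuU : forall A B, A `&` B = set0 -> nu (A `|` B) = nu A + nu B)
  (Xh : hausdorff_space X) (Xc : compact [set: X]).

Let nu_le A B : A `<=` B -> nu A <= nu B.
Proof.
move=> AB; rewrite -(setDUK AB) nuU ?lerDl //.
by rewrite setDIK.
Qed.

(** Only the values of the finitely additive [nu] on compact sets are kept, so that countable open
    covers may be replaced by finite ones. *)
Definition inner_content (U : set X) : \bar R :=
  ereal_sup [set (nu K)%:E | K in [set K | compact K /\ K `<=` U]].

(* Finite additivity suffices: compactness yields countable subadditivity. *)
Definition outer_content (A : set X) : \bar R :=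
  ereal_inf [set inner_content U | U in [set U | open U /\ A `<=` U]].

Local Open Scope ereal_scope.

Let inner_ge U K : compact K -> K `<=` U -> (nu K)%:E <= inner_content U.
Proof. by move=> cK KU; apply: ereal_sup_ubound; exists K. Qed.

Let inner_le U V : U `<=` V -> inner_content U <= inner_content V.
Proof.
move=> UV; apply/ereal_supP => _ [K [cK KU] <-].
by apply: inner_ge => //; exact: subset_trans UV.
Qed.

Let nu0 : nu set0 = 0%R.
Proof. by have := nuU (setIid (@set0 X)); rewrite setUid; lra. Qed.

Let inner_ge0 U : 0 <= inner_content U.
Proof. by rewrite -[0]/(0%R%:E) -nu0; apply: inner_ge => //; exact: compact0. Qed.

Let outer_open U : open U -> outer_content U = inner_content U.
Proof.
move=> oU; apply/eqP; rewrite eq_le; apply/andP; split.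
  by apply: ereal_inf_lbound; exists U => //; split.
by apply/ereal_infP => _ [V [oV UV] <-]; exact: inner_le.
Qed.

Let inner_le1 U : inner_content U <= 1.
Proof.
by apply/ereal_supP => _ [K _ <-]; rewrite lee_fin -nuT; exact: nu_le.
Qed.

Let outer_ge0 A : 0 <= outer_content A.
Proof. by apply/ereal_infP => _ [U _ <-]; exact: inner_ge0. Qed.

Let outer_le A B : A `<=` B -> outer_content A <= outer_content B.
Proof.
move=> AB; apply/ereal_infP => _ [U [oU BU] <-].
by apply: ereal_inf_lbound; exists U => //; split => //; exact: subset_trans BU.
Qed.

Let inner_fin U : inner_content U \is a fin_num.
Proof. by rewrite ge0_fin_numE // (le_lt_trans (inner_le1 U)) ?ltry. Qed.

Let outer_fin A : outer_content A \is a fin_num.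
Proof.
rewrite ge0_fin_numE //; apply: (@le_lt_trans _ _ (inner_content [set: X])).
  by apply: ereal_inf_lbound; exists [set: X] => //; split => //; exact: openT.
by rewrite ltey_eq inner_fin.
Qed.

(** Normality separates the closed sets [K \ U] and [K \ V] by disjoint open sets; removing either
    of these from [K] gives the two pieces. *)
Let compact_split (K U V : set X) : compact K -> open U -> open V -> K `<=` U `|` V ->
  exists K1 K2, [/\ compact K1, compact K2, K1 `<=` U, K2 `<=` V & K = K1 `|` K2].
Proof.
move=> cK oU oV KUV; have clK := compact_closed Xh cK.
have /(@normal_openP R)/(_ (K `\` U) (K `\` V)) := compact_normal Xh Xc.
have clD W : open W -> closed (K `\` W) by move=> oW; apply: closedI => //; exact: open_closedC.
have KUV0 : (K `\` U) `&` (K `\` V) = set0.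
  by apply/seteqP; split => // x [[Kx nU] [_ nV]]; case: (KUV x Kx).
move=> /(_ (clD _ oU) (clD _ oV) KUV0) [W1 [W2 [oW1 oW2 KW1 KW2 W12]]].
have cD W : open W -> compact (K `\` W).
  move=> oW; apply: (subclosed_compact _ cK); last by move=> x [].
  exact: clD.
exists (K `\` W1), (K `\` W2); split; [exact: cD | exact: cD | | |].
- by move=> x [Kx nO]; apply: contrapT => nU; apply: nO; apply: KW1.
- by move=> x [Kx nO]; apply: contrapT => nU; apply: nO; apply: KW2.
- apply/seteqP; split => [x Kx|x [[]|[]]//].
  have [W1x|] := pselect (W1 x); last by left.
  right; split => // W2x; have : (W1 `&` W2) x by [].
  by rewrite W12.
Qed.

Let nuU_le A B : (nu (A `|` B) <= nu A + nu B)%R.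
Proof.
have -> : A `|` B = A `|` (B `\` A).
  apply/seteqP; split => x [Ax|]; [by left| |by left|by case; right].
  by have [|nAx] := pselect (A x); [left|right].
by rewrite nuU ?setDIK // lerD2l; apply: nu_le => x [].
Qed.

Let inner_finite (U : (set X)^nat) n K : (forall i, open (U i)) -> compact K ->
  K `<=` \bigcup_(i < n) U i -> (nu K)%:E <= \sum_(i < n) inner_content (U i).
Proof.
move=> oU; elim: n K => [|n IH] K cK KU.
  by rewrite bigcup_mkord big_ord0 subset0 in KU; rewrite KU nu0 big_ord0.
rewrite bigcup_mkord big_ord_recr /= in KU.
have oV : open (\big[setU/set0]_(i < n) U i) by rewrite -bigcup_mkord; exact: bigcup_open.
have [K1 [K2 [cK1 cK2 K1U K2U ->]]] := compact_split cK oV (oU n) KU.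
rewrite big_ord_recr /= (le_trans (_ : _ <= (nu K1 + nu K2)%:E)) ?lee_fin ?nuU_le //.
by rewrite EFinD leeD ?inner_ge // IH // bigcup_mkord.
Qed.

Let outer_sigma_subadditive : sigma_subadditive outer_content.
Proof.
move=> F; apply/lee_addgt0Pr => e e0.
have /choice[U UP] : forall n, exists V, [/\ open V, F n `<=` V
    & inner_content V <= outer_content (F n) + (e / (2 ^ n.+1)%:R)%:E].
  move=> n.
  have en : (0 < e / (2 ^ n.+1)%:R :> R)%R by rewrite divr_gt0 // ltr0n expn_gt0.
  have [_ [U [oU FU] <-] Ule] := lb_ereal_inf_adherent en (outer_fin (F n)).
  by exists U; split => //; exact: ltW.
have oUn n : open (U n) by have [] := UP n.
apply: (@le_trans _ _ (inner_content (\bigcup_n U n))).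
  apply: ereal_inf_lbound; exists (\bigcup_n U n) => //; split; first exact: bigcup_open.
  by apply: subset_bigcup => n _; have [] := UP n.
apply: (@le_trans _ _ (\sum_(n <oo) (inner_content (U n)))); last first.
  apply: le_trans (epsilon_trick _ _ (ltW e0)) => //.
  by apply: lee_nneseries => // n _; have [] := UP n.
apply/ereal_supP => _ [K [cK KU] <-].
have /compact_near_coveringP/(_ nat \oo (fun n x => exists2 i, (i < n)%N & U i x) _) := cK.
case=> [x /KU [i _ Uix]|N _ /(_ N (leqnn N)) KN].
  exists (U i, [set n | (i < n)%N]); last by move=> [x' n] /= [? ?]; exists i.
  split; [exact: open_nbhs_nbhs (conj (oUn i) Uix) | exact: nbhs_infty_gt].
apply: (@le_trans _ _ (\sum_(i < N) inner_content (U i))); first exact: inner_finite.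
by rewrite -(big_mkord xpredT (fun i => inner_content (U i)))%E; exact: nneseries_lim_ge.
Qed.

(** Exhaust [U & V] by a compact [K] first, then the open set [U \ K] by a compact [K']. These are
    disjoint and lie in [U], and [nu] is additive on them. *)
Let outer_caratheodory V Y : open V ->
  outer_content (Y `&` V) + outer_content (Y `&` ~` V) <= outer_content Y.
Proof.
move=> oV.
apply/ereal_infP => _ [U [oU YU] <-].
rewrite -leeBrDr ?outer_fin //; apply: (@le_trans _ _ (inner_content (U `&` V))).
  rewrite -outer_open; last exact: openI.
  by apply: outer_le; exact: setSI.
apply/ereal_supP => _ [K [cK KUV] <-].
rewrite leeBrDr ?outer_fin // addeC -leeBrDr //.
apply: (@le_trans _ _ (inner_content (U `\` K))).
  rewrite -outer_open; last first.
    by rewrite setDE; apply: openI => //; exact/closed_openC/(compact_closed Xh cK).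
  by apply: outer_le => x [Yx nVx]; split; [exact: YU | move=> /KUV []].
apply/ereal_supP => _ [K' [cK' K'U] <-]; rewrite leeBrDr // -EFinD addrC -nuU.
  by apply: inner_ge; [exact: compactU | move=> x [/KUV []|/K'U []]].
by apply/seteqP; split => // x [Kx /K'U []].
Qed.

(** Open sets are Caratheodory measurable, so the outer measure restricts to the Borel sets; the
    total mass is 1 because the whole space is compact. *)
Lemma content_probability (x0 : X) : exists mu : probability (borel x0) R,
  forall A, mu A = outer_content A.
Proof.
have outer0 : outer_content set0 = 0.
  rewrite outer_open; last exact: open0.
  apply/eqP; rewrite eq_le inner_ge0 andbT.
  by apply/ereal_supP => _ [K [_ K0] <-]; move: K0; rewrite subset0 => ->; rewrite nu0.
pose om := isOuterMeasure.Build R (pointed_at x0) outer_content outer0 outer_ge0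
  outer_le outer_sigma_subadditive.
pose mu : {outer_measure set (pointed_at x0) -> \bar R} := HB.pack outer_content om.
have sub (A : set (borel x0)) : measurable A -> mu.-cara.-measurable A.
  move=> mA; apply: mA; split; last first.
    move=> U oU; apply: (le_caratheodory_measurable (mu := mu)) => Y.
    exact: outer_caratheodory.
  exact: sigma_algebra_measurable.
have add : semi_sigma_additive (outer_content : set (borel x0) -> \bar R).
  move=> F mF tF mU.
  by apply: (@caratheodory_measure_sigma_additive R (pointed_at x0) mu) => [n||];
    [exact: sub | exact: tF | exact: sub].
have om0 : (outer_content : set (borel x0) -> \bar R) set0 = 0 by [].
pose mm := isMeasure.Build _ (borel x0) R (outer_content : set (borel x0) -> \bar R)
  om0 outer_ge0 add.
pose mm' : {measure set (borel x0) -> \bar R} := HB.pack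
  (outer_content : set (borel x0) -> \bar R) mm.
have mT : mm' setT = 1.
  rewrite /= (outer_open openT); apply/eqP; rewrite eq_le inner_le1 /=.
  by rewrite -nuT; exact: inner_ge.
pose pp := Measure_isProbability.Build _ (borel x0) R mm' mT.
pose P : probability (borel x0) R := HB.pack
  (outer_content : set (borel x0) -> \bar R) mm pp.
by exists P.
Qed.

End regular_content.

(** Invariance survives the regularisation because every [a g] permutes the compact sets and the
    open sets. *)
Lemma amenable_invariant_probability (R : realType) (G : groupType)
    (X : topologicalType) (a : gaction G X) :
  hausdorff_space X -> compact [set: X] -> [set: X] !=set0 ->
  amenable G R -> has_invariant_probability R a.
Proof.
move=> Xh Xc [x0 _] [m [m0 mT mU mG]].
pose nu A := m [set g | A (a g x0)].
have aK g : cancel (a g) (a g^-1%g) by move=> x; rewrite -act_mul mulVg act_one.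
have aVK g : cancel (a g^-1%g) (a g) by move=> x; rewrite -act_mul mulgV act_one.
have nuG g A : nu (a g @^-1` A) = nu A.
  rewrite /nu -(mG g); congr m; apply/seteqP; split => [_ [h Ah <-]|h Ah] /=.
    by rewrite act_mul.
  by exists (g^-1 * h)%g; rewrite /= ?mulVKg // act_mul aVK.
have nuU A B : A `&` B = set0 -> nu (A `|` B) = nu A + nu B.
  move=> AB; rewrite /nu -mU //; apply/seteqP; split => // g [Ag Bg].
  by have : (A `&` B) (a g x0) by []; rewrite AB.
have [mu muE] := @content_probability R X nu (fun A => m0 _) mT nuU Xh Xc x0.
exists x0, mu => g A mA; rewrite !muE.
have preim h (U : set X) : open U -> open (a h @^-1` U).
  by move=> oU; apply: open_comp => // x _; exact: act_continuous.
have inner_inv U : inner_content nu (a g @^-1` U) = inner_content nu U.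
  have step h (V : set X) : (inner_content nu V <= inner_content nu (a h @^-1` V))%E.
    apply/ereal_supP => _ [K [cK KV] <-]; apply: ereal_sup_ubound.
    exists (a h @^-1` K); last by rewrite nuG.
    split => [|x]; last exact: KV.
    rewrite (_ : _ @^-1` K = a h^-1%g @` K).
      by apply: continuous_compact => //; apply: continuous_subspaceT; exact: act_continuous.
    by apply/seteqP; split => [x Kx|_ [y Ky <-]]; [exists (a h x); rewrite ?aK | rewrite /= aVK].
  apply/eqP; rewrite eq_le step andbT.
  have := step g^-1%g (a g @^-1` U); rewrite (_ : _ @^-1` (_ @^-1` U) = U) //.
  by apply/seteqP; split => x /=; rewrite aVK.
rewrite /outer_content; congr ereal_inf; apply/seteqP; split=> _ [U [oU AU] <-].
  exists (a g^-1%g @^-1` U); last first.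
    rewrite -inner_inv (_ : _ @^-1` (_ @^-1` U) = U) //.
    by apply/seteqP; split => x /=; rewrite aK.
  split; first exact: preim.
  by move=> x Ax; apply: AU; rewrite /= aVK.
exists (a g @^-1` U); last exact: inner_inv.
by split; [exact: preim | move=> x; exact: AU].
Qed.

(** * Invariant clopen partitions of an equicontinuous Cantor system *)

(** The set [Q], the quasi-component of [x], is connected in a compact Hausdorff space; if no clopen
    set separated [x] from [y], it would contain both. *)
Lemma compact_totally_disconnected_zero_dimensional (R : realType)
    (X : topologicalType) :
  hausdorff_space X -> compact [set: X] -> totally_disconnected [set: X] ->
  zero_dimensional X.
Proof.
move=> Xh Xc Xtd x y xy; apply: contrapT => /forallNP noU.
pose Q := [set z | forall U, clopen U -> U x -> U z].
have Qx : Q x by [].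
have Qy : Q y.
  by move=> U cU Ux; apply: contrapT => nUy; apply: (noU U).
have clQ : closed Q.
  rewrite (_ : Q = \bigcap_(U in [set U | clopen U /\ U x]) U).
    by apply: closed_bigI => U [[]].
  by apply/seteqP; split => z Qz U; [case; exact: Qz | move=> cU Ux; apply: Qz].
(* a separation of [Q] extends, by normality and compactness, to a clopen set *)
have Qsep U V : open U -> open V -> U `&` V = set0 -> Q `<=` U `|` V -> U x ->
    Q `<=` U.
  move=> oU oV UV QUV Ux.
  have cK : compact (~` (U `|` V)).
    apply: (subclosed_compact _ Xc) => //; apply: open_closedC; exact: openU.
  have [C cC [Cx CUV]] : exists2 C : set X, clopen C & C x /\ C `<=` U `|` V.
    apply: contrapT => nC.
    pose F := filter_from [set C : set X | clopen C /\ C x]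
      (fun C => C `&` ~` (U `|` V)).
    have FF : ProperFilter F.
      apply: filter_from_proper.
        apply: filter_from_filter; first by exists setT; split => //; exact: clopenT.
        move=> C C' [cC Cx] [cC' C'x]; exists (C `&` C') => //.
          by split => //; exact: clopenI.
        by move=> z [[? ?] ?].
      move=> C [cC Cx]; apply: contrapT => nex; apply: nC; exists C => //; split => //.
      by move=> z Cz; apply: contrapT => nUV; apply: nex; exists z.
    have FK : F (~` (U `|` V)).
      by exists setT; [split => //; exact: clopenT | move=> z []].
    have [z [nUVz clz]] := cK F _ FK; apply: nUVz; apply: QUV => C cC Cx.
    have : closure C z.
      move=> W Wz; have [||w [[Cw _] Ww]] := clz (C `&` ~` (U `|` V)) W.
      - by exists C; [split|].
      - by [].
      - by exists w.
    by rewrite -(closure_id C).1 //; case: cC.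
  move=> z Qz; suff [] : (C `&` U) z by [].
  apply: Qz => //; case: cC => oC cC; split; first exact: openI.
  rewrite (_ : C `&` U = C `&` ~` V); first by apply: closedI => //; exact: open_closedC.
  apply/seteqP; split => w [Cw Uw]; split => //.
    by move=> Vw; have : (U `&` V) w by []; rewrite UV.
  by case: (CUV w Cw).
have conQ : connected Q.
  apply: contrapT => /connectedPn[E [E0 QE [sep1 sep2]]].
  have clE b : closed (E b).
    rewrite closure_id; apply/seteqP; split; first exact: subset_closure.
    move=> z clz; have : Q z.
      by rewrite (closure_id Q).1 // QE; apply: closureS clz => w; case: b; [right|left].
    rewrite QE; case: b clz => clz [] // Ez.
      by have : (E false `&` closure (E true)) z by []; rewrite sep2.
    by have : (closure (E false) `&` E true) z by []; rewrite sep1.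
  have E12 : E false `&` E true = set0.
    by apply/seteqP; split => // z [/subset_closure Ez Ez']; rewrite -sep1.
  have [U [V [oU oV EU EV UV]]] :=
    (@normal_openP R X).1 (compact_normal Xh Xc) _ _ (clE false) (clE true) E12.
  have QUV : Q `<=` U `|` V by rewrite QE => z [/EU|/EV]; [left|right].
  move: Qx; rewrite QE => -[/EU Ux|/EV Vx].
    have [z Ez] := E0 true; have : (U `&` V) z.
      by split; [apply: Qsep oU oV UV QUV Ux _ _; rewrite QE; right | exact: EV].
    by rewrite UV.
  have [z Ez] := E0 false; have : (U `&` V) z.
    split; first exact: EU; rewrite setUC in QUV; rewrite setIC in UV.
    by apply: Qsep oV oU UV QUV Vx _ _; rewrite QE; left.
  by rewrite UV.
have : connected_component [set: X] x y by exact: connected_component_max Qx _ conQ _ Qy.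
by rewrite Xtd // => yx; move: xy; rewrite yx eqxx.
Qed.

(** Makes the enumeration [clopen_surj] of clopen sets applicable to a phase space with a chosen
    point. *)
HB.instance Definition _ (R : realType) (X : metricType R) (x0 : X) :=
  PseudoMetric.copy (pointed_at x0) X.

(* The classes of the relations [block n] are clopen sets permuted by [G] and
   shrink to points: they replace the finite quotients of [Z]. *)
Record block_system (G : groupType) (Z : topologicalType) (a : gaction G Z) :=
  BlockSystem {
    block :> nat -> Z -> Z -> Prop;
    block_refl : forall n z, block n z z;
    block_sym : forall n z z', block n z z' -> block n z' z;
    block_trans : forall n z z' z'', block n z z' -> block n z' z'' -> block n z z'';
    block_act : forall n g z z', block n z z' -> block n (a g z) (a g z');
    block_le : forall m n z z', (m <= n)%N -> block n z z' -> block m z z';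
    block0 : forall z z', block 0 z z';
    block_near : forall n z, \forall z' \near z, block n z z';
    block_basis : forall z U, nbhs z U -> exists n, forall z', block n z z' -> U z' }.

Section block_system_of_equicontinuous.
Context (R : realType) (G : groupType) (Z : tds R G).
Hypotheses (Zeq : equicontinuous_tds Z) (Ztd : totally_disconnected [set: Z]).

Let Zh : hausdorff_space Z := @metric_hausdorff R Z.

(** [d] is a Lebesgue number of the partition into [C] and its complement. *)
Lemma clopen_uniform (C : set Z) : clopen C -> exists2 d : R, 0 < d &
  forall y y' : Z, mdist y y' < d -> (C y <-> C y').
Proof.
move=> [oC cC].
have /compact_near_coveringP cov := @phase_compact R G Z.
have unif : \forall d \near (0 : R)^'+,
    [set: Z] `<=` [set y | forall y', mdist y y' < d -> (C y <-> C y')].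
  apply: cov => y _.
  have [r r0 rP] : exists2 r : R, 0 < r & forall y', mdist y y' < r -> (C y <-> C y').
    have [Cy|nCy] := pselect (C y).
      have /nbhs_ballP[r r0 rC] : nbhs y C by exact: open_nbhs_nbhs.
      by exists r => // y' yy'; split => // _; apply: rC; rewrite ballEmdist.
    have /nbhs_ballP[r r0 rC] : nbhs y (~` C).
      by apply: open_nbhs_nbhs; split => //; exact: closed_openC.
    by exists r => // y' yy'; split => // Cy'; have := rC y'; rewrite ballEmdist => /(_ yy').
  have r20 : 0 < r / 2 by rewrite divr_gt0.
  exists (ball y (r / 2), [set d | d < r / 2]).
    by split; [exact: nbhsx_ballx | exact: nbhs_right_lt].
  move=> [y1 d] /=; rewrite ballEmdist /= => -[yy1 dr] y2 y12.
  rewrite -(rP y1); last by rewrite (lt_le_trans yy1) // ler_piMr ?ltW // invf_lt1 // ltr1n.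
  apply: rP; apply: le_lt_trans (metric_triangle _ y1 _) _.
  by rewrite [r]splitr ltrD // (lt_trans y12).
near (0 : R)^'+ => d; exists d; first by near: d; exact: nbhs_right_gt.
by move=> y y'; apply: (near unif d).
Unshelve. all: by end_near. Qed.

(** Two points are in the same block of level [n] when their whole orbits have the same itinerary
    through the first [n] sets of an enumeration of the clopen sets. Quantifying over all of [G]
    makes the relation invariant; equicontinuity keeps its classes open. *)
Lemma equicontinuous_block_system : inhabited (block_system (tact Z)).
Proof.
have [x0 _] := @phase_neq0 R G Z.
have [C] := @clopen_surj R (pointed_at x0) (@phase_compact R G Z).
have cC i : clopen (C i : set Z) by exact: (@funS _ _ _ _ C i I).
pose E n (z z' : Z) := forall i g, (i < n)%N -> (C i (tact Z g z) <-> C i (tact Z g z')).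
have Enear n z : \forall z' \near z, E n z z'.
  elim: n => [|n IH]; first by apply: nearW.
  have [d d0 dP] := clopen_uniform (cC n).
  have [d' d'0 d'P] := Zeq d0.
  apply: filterS2 IH (nbhsx_ballx z _ d'0) => z' zz'.
  rewrite ballEmdist => zz'd i g; rewrite ltnS leq_eqVlt => /predU1P[->|]; last exact: zz'.
  by apply: dP; exact: d'P.
have Erefl n z : E n z z by [].
have Esym n z z' : E n z z' -> E n z' z by move=> zz' i g ilt; rewrite zz'.
have Etrans n z z' z'' : E n z z' -> E n z' z'' -> E n z z''.
  by move=> zz' zz'' i g ilt; rewrite zz' // zz''.
have Ele m n z z' : (m <= n)%N -> E n z z' -> E m z z'.
  by move=> mn zz' i g im; apply: zz'; exact: leq_trans mn.
have Esep z z' : z != z' -> exists n, ~ E n z z'.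
  have Zzd := compact_totally_disconnected_zero_dimensional R Zh (@phase_compact R G Z) Ztd.
  move=> /Zzd[U [cU Uz nUz']]; have [i _ Ci] := @surj _ _ _ _ C U cU.
  by exists i.+1 => /(_ i 1%g (ltnSn i)); rewrite !act_one Ci => -[/(_ Uz)].
constructor; exists E => //.
- by move=> n g z z' zz' i h ilt; rewrite -!act_mul; exact: zz'.
- move=> z U; rewrite nbhsE => -[V [oV Vz] VU].
  have cK : compact (~` V).
    by apply: (subclosed_compact _ (@phase_compact R G Z)) => //; exact: open_closedC.
  have /compact_near_coveringP/(_ nat \oo (fun n y => ~ E n z y) _) := cK.
  case=> [y nVy|N _ /(_ N (leqnn N)) KN].
    have [n nE] : exists n, ~ E n z y.
      by apply: Esep; apply/eqP => zy; apply: nVy; rewrite -zy.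
    exists ([set y' | E n y y'], [set m | (n <= m)%N]).
      by split; [exact: Enear | exact: nbhs_infty_ge].
    move=> [y' m] /= [yy' nm] Em; apply: nE; apply: Etrans (Ele _ _ _ _ nm Em) _.
    exact: Esym.
  exists N => z' zz'; apply: VU; apply: contrapT => nV; exact: (KN z').
Qed.

End block_system_of_equicontinuous.

Section blocks.
Context (G : groupType) (Z : topologicalType) (a : gaction G Z).
Hypotheses (Zh : hausdorff_space Z) (Zc : compact [set: Z])
  (Zmin : forall z, dense (gorbit a z)).

Lemma block_separates (E : block_system a) z z' : z <> z' -> exists n, ~ E n z z'.
Proof.
move=> /eqP zz'; have [U [oU Uz nUz']] := hausdorff_accessible Zh zz'.
have [|n nU] := @block_basis _ _ _ E z U.
  by apply: open_nbhs_nbhs; split => //; exact: set_mem.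
by exists n => /nU; exact: set_mem nUz'.
Qed.

Lemma block_cluster (E : block_system a) (f : nat -> Z) :
  exists y, forall n N, exists2 M, (N <= M)%N & E n y (f M).
Proof.
have [y [_ yf]] := @Zc (f @ \oo) _ filterT.
exists y => n N; have [||_ [[M NM <-] yM]] := yf (f @` [set M | (N <= M)%N]) [set z | E n y z].
- by apply: filterS (nbhs_infty_ge N) => M NM; exists M.
- exact: block_near.
- by exists M.
Qed.

Lemma orbit_meets_block (E : block_system a) z y n : exists g, E n y (a g z).
Proof.
have yE := block_near E n y.
have [||w [/interior_subset yw [g _ gw]]] := Zmin z (O := [set z | E n y z]°).
- by exists y; exact: yE.
- exact: open_interior.
- by exists g; rewrite gw.
Qed.

Hypothesis Zperf : isolated [set: Z] = set0.

Lemma block_perfect (E : block_system a) z n : exists2 z', z' <> z & E n z z'.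
Proof.
apply: contrapT => noz; have : isolated [set: Z] z; last by rewrite Zperf.
split; first exact: in_setT.
exists [set z' | E n z z']; first exact: block_near.
rewrite setIT; apply/seteqP; split => [z' zz'|_ ->]; last exact: block_refl.
by apply: contrapT => ne; apply: noz; exists z'.
Qed.

(** A Baire argument with nested blocks: a pair of a point and a level stands for a block, stage [k]
    shrinks it so as to miss the orbit point of code [k], and a cluster point of the centres lies in
    all of them. Perfectness leaves room to move away when the centre is itself that orbit point. *)
Lemma exists_off_orbit (E : block_system a) z0 : countable [set: G] ->
  exists z1, forall g, a g z0 <> z1.
Proof.
move=> /countable_injP[code /in2TT codeI].
pose avoid k (w : Z * nat) := forall g, code g = k -> ~ E w.2 (a g z0) w.1.
have /choice[F FP] : forall kw : nat * (Z * nat), exists w',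
    [/\ (kw.2.2 <= w'.2)%N, E kw.2.2 kw.2.1 w'.1 & avoid kw.1 w'].
  move=> [k [w n]] /=.
  have [[g gk]|nog] := pselect (exists g, code g = k); last first.
    by exists (w, n); split => //; [exact: block_refl | move=> g gk; case: nog; exists g].
  have [w' w'E [m mw']] : exists2 w', E n w w' & exists m, ~ E m (a g z0) w'.
    have [gw|/(block_separates E) ?] := pselect (a g z0 = w); last first.
      by exists w => //; exact: block_refl.
    have [w' /nesym ne ww'] := block_perfect E w n.
    by exists w' => //; rewrite gw; exact: block_separates.
  exists (w', maxn m n); split => //=; first exact: leq_maxr.
  move=> h; rewrite -gk => /codeI -> /= Em; apply: mw'.
  exact: block_le (leq_maxl _ _) Em.
pose w := fix w n := if n is k.+1 then F (k, w k) else (z0, 0%N).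
have wle m n : (m <= n)%N -> ((w m).2 <= (w n).2)%N /\ E (w m).2 (w m).1 (w n).1.
  move=> /subnKC <-; elim: (n - m)%N => [|j [le1 E1]]; rewrite ?addn0 ?addnS.
    by split => //; exact: block_refl.
  have [le2 E2 _] := FP ((m + j)%N, w (m + j)%N).
  split; first exact: leq_trans le2.
  by apply: block_trans E1 _; apply: block_le E2.
have [y yP] := block_cluster E (fun n => (w n).1).
exists y => g gy; have [_ _ av] := FP (code g, w (code g)).
apply: (av g erefl); have [M NM yM] := yP (w (code g).+1).2 (code g).+1.
rewrite gy; apply: block_trans yM _; apply: block_sym.
by have [] := wle _ _ NM.
Qed.

(** Thinning out the levels makes every annulus around [z1] non-empty, so that the parity of annuli
    does oscillate at [z1]. *)
Lemma block_subsequence (E : block_system a) z1 : exists E' : block_system a,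
  forall k, exists2 z, E' k z1 z & ~ E' k.+1 z1 z.
Proof.
have /choice[next nextP] : forall n, exists m, exists2 z, E n z1 z & ~ E m z1 z.
  move=> n; have [z /nesym ne zE] := block_perfect E z1 n.
  by have [m mE] := block_separates E ne; exists m, z.
have next_gt n : (n < next n)%N.
  rewrite ltnNge; apply/negP => le; have [z zE] := nextP n; apply.
  exact: block_le zE.
pose sub k := iter k next 0%N.
have sub_ge k : (k <= sub k)%N.
  by elim: k => // k IH; apply: leq_ltn_trans IH (next_gt _).
have sub_le m n : (m <= n)%N -> (sub m <= sub n)%N.
  move=> /subnKC <-; elim: (n - m)%N => [|j IH]; rewrite ?addn0 ?addnS //.
  by apply: leq_trans IH _; exact: ltnW.
unshelve eexists (@BlockSystem _ _ _ (fun k => E (sub k)) _ _ _ _ _ _ _ _).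
- by move=> n z; exact: block_refl.
- by move=> n z z'; exact: block_sym.
- by move=> n z z' z''; exact: block_trans.
- by move=> n g z z'; exact: block_act.
- by move=> m n z z' mn; apply: block_le; exact: sub_le.
- by move=> z z'; exact: block0.
- by move=> n z; exact: block_near.
- move=> z U zU; have [n nU] := block_basis E zU.
  by exists n => z' zz'; apply: nU; apply: block_le zz'.
- by move=> k /=; exact: nextP.
Qed.

End blocks.

(** * A two-symbol coding with one discontinuity *)

Section parity_coding.
Context (G : groupType) (Z : topologicalType) (a : gaction G Z).
Hypotheses (Zh : hausdorff_space Z) (Zc : compact [set: Z])
  (Zmin : forall z, dense (gorbit a z)).
Context (E : block_system a) (z1 : Z).
Hypothesis annuli : forall k, exists2 z, E k z1 z & ~ E k.+1 z1 z.

Definition annulus k z := E k z1 z /\ ~ E k.+1 z1 z.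

(* Locally constant away from [z1], and oscillating at [z1]. *)
Definition annulus_parity (z : Z) : bool := `[< exists2 k, odd k & annulus k z >].

Lemma annulus_uniq j k z : annulus j z -> annulus k z -> j = k.
Proof.
move=> [Ej nEj] [Ek nEk]; apply/eqP; rewrite eqn_leq leqNgt [(k <= j)%N]leqNgt.
apply/andP; split; apply/negP => lt; first by apply: nEk; exact: block_le Ej.
by apply: nEj; exact: block_le Ek.
Qed.

Lemma annulus_parityE k z : annulus k z -> annulus_parity z = odd k.
Proof.
move=> kz; apply/asboolP/idP => [[j oj /annulus_uniq/(_ kz) <-] //|ok].
by exists k.
Qed.

Lemma exists_annulus z : z <> z1 -> exists k, annulus k z.
Proof.
move=> /nesym/(block_separates Zh E) [n nE].
elim: n nE => [|n IH] nE; first by case: nE; exact: block0.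
by have [En|/IH //] := pselect (E n z1 z); exists n.
Qed.

Lemma annulus_block k n z z' : (k < n)%N -> annulus k z -> E n z z' -> annulus k z'.
Proof.
move=> kn [Ek nEk] zz'; split.
  by apply: block_trans Ek _; apply: block_le zz'; exact: ltnW.
move=> E'; apply: nEk; apply: block_trans E' _.
by apply/block_sym/block_le/zz'.
Qed.

(* If [h i] and [h j] move [y'] into the same block, then [(h i)^-1 * h j] fixes
   the block of [y'], and for [i < j] it moves [z1] like [(h i)^-1] does. *)
Let return_annulus (y' : Z) n b N : exists k j,
  [/\ odd j = b, (N <= j)%N, E n y' (a k y') & annulus j (a k z1)].
Proof.
have /choice[h hP] : forall m, exists g, annulus (m.*2 + b) (a g z1).
  move=> m; have [z mz] := annuli (m.*2 + b)%N; move=> nmz.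
  have [g zg] := orbit_meets_block Zmin E z1 z (m.*2 + b).+1.
  by exists g; apply: annulus_block zg.
have [y yP] := block_cluster Zc E (fun m => a (h m) y').
have [i Ni yi] := yP n N; have [j ij yj] := yP n i.+1.
exists ((h i)^-1 * h j)%g, (i.*2 + b)%N; split.
- by rewrite oddD odd_double; case: b {h hP y yP yi yj}.
- by apply: leq_trans Ni _; rewrite -addnn -addnA leq_addr.
- have := block_act (h i)^-1%g (block_trans (block_sym yi) yj).
  by rewrite -!act_mul mulVg act_one.
- have [Ej _] := hP j; have := block_act (h i)^-1%g Ej; rewrite -act_mul => Ej'.
  have [Ei nEi] := hP i.
  have inv_i : annulus (i.*2 + b) (a (h i)^-1%g z1).
    split; first by have := block_act (h i)^-1%g (block_sym Ei); rewrite -act_mul mulVg act_one.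
    move=> Ei1; apply: nEi; have := block_act (h i) (block_sym Ei1).
    by rewrite -act_mul mulgV act_one.
  apply: annulus_block inv_i Ej' => //.
  by rewrite ltn_add2r ltn_double.
Qed.

(** Move [z] very close to [z1] by [g M]; then [z'] goes to a fixed annulus [r], near a cluster
    point [y']. Elements returning [y'] to its block keep [z'] in annulus [r], yet drag [z], along
    with [z1], into annuli of either parity. Equal parities throughout are thus impossible. *)
Lemma annulus_parity_separates z z' : z <> z' ->
  exists g, [/\ a g z <> z1, a g z' <> z1 & annulus_parity (a g z) <> annulus_parity (a g z')].
Proof.
move=> /(block_separates Zh E)[n nE]; apply: contrapT => noex.
have same g : a g z <> z1 -> a g z' <> z1 ->
    annulus_parity (a g z) = annulus_parity (a g z').
  by move=> gz gz'; apply: contrapT => ne; apply: noex; exists g.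
have /choice[g gP] : forall m, exists g, E m z1 (a g z).
  by move=> m; exact: orbit_meets_block.
have [y' yP] := block_cluster Zc E (fun m => a (g m) z').
have [k0 [j0 [oj0 nj0 k0y k0z]]] := return_annulus y' n false n.
have [k1 [j1 [oj1 nj1 k1y k1z]]] := return_annulus y' n true n.
(* [M] exceeds [j0] and [j1], so that [k0] and [k1] send the image of [z] into the same annuli as
   [z1]. *)
have [M /[!geq_max] /andP[nM /andP[j0M j1M]] yM] := yP n (maxn n (maxn j0.+1 j1.+1)).
have gE := gP M.
have far h : E n z1 (a h z) -> ~ E n z1 (a h z').
  move=> hz hz'; apply: nE; have := block_act h^-1%g (block_trans (block_sym hz) hz').
  by rewrite -!act_mul mulVg !act_one.
have nz'1 h : E n z1 (a h z) -> a h z' <> z1.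
  by move=> /far + e; rewrite e; apply; exact: block_refl.
have gMz' : ~ E n z1 (a (g M) z') by apply: far; exact: block_le gE.
have [r rz'] := exists_annulus (nz'1 _ (block_le nM gE)).
have rn : (r < n)%N.
  by rewrite ltnNge; apply/negP => nr; apply: gMz'; exact: block_le nr rz'.1.
have step k j : (n <= j)%N -> (j < M)%N -> E n y' (a k y') -> annulus j (a k z1) ->
    odd j = odd r.
  move=> nj jM ky kz; have kgz : annulus j (a (k * g M)%g z).
    by rewrite act_mul; apply: annulus_block jM kz _; exact: block_act.
  have kgz' : annulus r (a (k * g M)%g z').
    apply: annulus_block rn rz' _; apply: block_trans (block_sym yM) _.
    by apply: block_trans ky _; rewrite act_mul; exact: block_act.
  have n1 : E n z1 (a (k * g M)%g z) by exact: block_le kgz.1.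
  rewrite -(annulus_parityE kgz) -(annulus_parityE kgz'); apply: same.
    by move=> e; case: kgz => _; apply; rewrite e; exact: block_refl.
  exact: nz'1.
have := step _ _ nj0 j0M k0y k0z; rewrite -(step _ _ nj1 j1M k1y k1z).
by rewrite oj0 oj1.
Qed.

End parity_coding.

(** * Subshifts *)

Section set_type_topology.
Context (T : topologicalType) (A : set T).

Lemma set_val_continuous : continuous (set_val : A -> T).
Proof. exact: initial_continuous. Qed.

Lemma compact_set_type : compact A -> compact [set: set_type A].
Proof.
move=> cA F FF _; have [|x [Ax clx]] := cA (set_val @ F) _.
  by apply: nearW => x; exact: set_valP.
exists (exist _ x (mem_set Ax)); split => // B N FB [_ [[W oW <-] Wx] WN].
have [||_ [[y By <-] Wy]] := clx (set_val @` B) W.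
- by apply: (@filterS _ F _ B) FB => y By; exists y.
- exact: open_nbhs_nbhs.
- by exists y; split => //; exact: WN.
Qed.

Lemma hausdorff_set_type : hausdorff_space T -> hausdorff_space (set_type A).
Proof.
move=> Th p q pq; apply/val_inj/Th => B C pB qC.
have [||x [Bx Cx]] := pq (set_val @^-1` B) (set_val @^-1` C).
- exact: set_val_continuous pB.
- exact: set_val_continuous qC.
- by exists (set_val x).
Qed.

End set_type_topology.

Section full_shifts.
Context (G : groupType) (S : finType).

Lemma near_value (x : full_shift G S) g : \forall x' \near x, x' g = x g.
Proof.
exact: (@proj_continuous G (fun=> discrete_topology S) g x _ (discrete_set1 _)).
Qed.

Lemma full_shift_compact : compact [set: full_shift G S].
Proof.
have cS : compact [set: discrete_topology S].
  by apply: finite_compact; exact: (@finite_finset S setT).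
have := @tychonoff G (fun=> discrete_topology S) _ (fun=> cS).
by congr (compact _); rewrite eqEsubset.
Qed.

Lemma full_shift_hausdorff : hausdorff_space (full_shift G S).
Proof. by apply: hausdorff_product => ?; exact: discrete_hausdorff. Qed.

Lemma subshift_compact (X : subshift G S) : compact [set: set_type X].
Proof.
by apply/compact_set_type/(subclosed_compact (@subshift_closed _ _ X) full_shift_compact).
Qed.

Lemma subshift_hausdorff (X : subshift G S) : hausdorff_space (set_type X).
Proof. exact/hausdorff_set_type/full_shift_hausdorff. Qed.

Lemma closure_orbit_near (x y : full_shift G S) (P : full_shift G S -> Prop) :
  closure (gorbit (full_shift_action G S) x) y -> (\forall y' \near y, P y') ->
  exists g, P (Defs.shift g x).
Proof. by move=> /[apply] -[_ [[g _ <-] Pg]]; exists g. Qed.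

Lemma orbit_closure_invariant (x : full_shift G S) g y :
  closure (gorbit (full_shift_action G S) x) y ->
  closure (gorbit (full_shift_action G S) x) (Defs.shift g y).
Proof.
move=> xy B /(@Defs.shift_continuous G S g) /xy [_ [[h _ <-] Bh]].
by exists (Defs.shift (g * h)%g x); split; [exists (g * h)%g | rewrite shiftM].
Qed.

Definition orbit_closure (x : full_shift G S) : subshift G S :=
  Subshift (@closed_closure _ _) (@orbit_closure_invariant x).

Lemma orbit_closure_self (x : full_shift G S) : points (orbit_closure x) x.
Proof. by apply: subset_closure; exists 1%g => //; rewrite /= shift1. Qed.

End full_shifts.

(** Integrating the inequality would give [c + 1 <= c] for a finite [c]. Each [f i] is the sum of
    the indicators of its open sets [j < f i], so invariance is applied to these sets only. *)
Lemma no_invariant_probability (R : realType) (G : groupType) (X : topologicalType)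
    (a : gaction G X) (I : finType) (s : I -> G) (J : nat) (f : I -> X -> nat) :
  (forall i x, (f i x <= J)%N) ->
  (forall i x, \forall x' \near x, f i x' = f i x) ->
  (forall x, (\sum_i f i (a (s i) x) < \sum_i f i x)%N) ->
  ~ has_invariant_probability R a.
Proof.
move=> fJ fnear fflow [x0 [mu inv]].
pose A (p : I * 'I_J) : set (borel x0) := [set x | (p.2 < f p.1 x)%N].
pose B (p : I * 'I_J) : set (borel x0) := [set x | (p.2 < f p.1 (a (s p.1) x))%N].
have oA p : open (A p : set X).
  rewrite openE => x Ax; apply: filterS (fnear p.1 x) => x' /= e.
  by rewrite /A /= e.
have mA p : measurable (A p) by exact: sub_sigma_algebra (oA p).
have mB p : measurable (B p).
  apply: sub_sigma_algebra; rewrite (_ : B p = a (s p.1) @^-1` A p) //.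
  by apply: open_comp (oA p) => x _; exact: act_continuous.
have AB p : mu (B p) = mu (A p) by rewrite -(inv (s p.1) _ (mA p)).
have sum_lt k n : (\sum_(j < k) (j < n) = minn k n)%N.
  elim: k => [|k IH]; first by rewrite big_ord0 min0n.
  by rewrite big_ord_recr /= IH; lia.
have countA i x : (\sum_(j < J) (j < f i x) = f i x)%N.
  by rewrite sum_lt; exact/minn_idPr.
have intE (C : I * 'I_J -> set (borel x0)) : (forall p, measurable (C p)) ->
    (\int[mu]_x (\sum_p (\1_(C p) x)%:E)%E = \sum_p mu (C p))%E.
  move=> mC; rewrite ge0_integral_sum //.
  - by apply: eq_bigr => p _; rewrite integral_indic // setIT.
  - by move=> p; apply/measurable_EFinP; exact: measurable_indic.
have mindic (C : I * 'I_J -> set (borel x0)) : (forall p, measurable (C p)) ->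
    measurable_fun setT (fun x => (\sum_p (\1_(C p) x)%:E)%E : \bar R).
  move=> mC; apply: emeasurable_sum => p; apply/measurable_EFinP.
  exact: measurable_indic.
have sum_ge0 (C : I * 'I_J -> set (borel x0)) x : (0 <= \sum_p (\1_(C p) x)%:E :> \bar R)%E.
  by apply: sume_ge0 => p _; rewrite lee_fin indicE.
have sumE (C : I * 'I_J -> set (borel x0)) (n : I -> nat) x :
    (forall i (j : 'I_J), C (i, j) x = (j < n i)%N :> Prop) ->
    (\sum_p (\1_(C p) x)%:E = (\sum_i \sum_(j < J) (j < n i))%N%:R%:E :> \bar R)%E.
  move=> Cn; rewrite sumEFin; congr (_%:E); rewrite natr_sum.
  under [RHS]eq_bigr do rewrite natr_sum.
  rewrite pair_big /=; apply: eq_bigr => -[i j] _ /=; rewrite indicE; congr (nat_of_bool _)%:R.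
  by apply/idP/idP; rewrite inE Cn.
have le_int : (\int[mu]_x (\sum_p (\1_(B p) x)%:E + 1)%E <=
    \int[mu]_x (\sum_p (\1_(A p) x)%:E)%E)%E.
  apply: ge0_le_integral => //.
  - by move=> x _; rewrite adde_ge0.
  - by apply: emeasurable_funD => //; exact: mindic.
  - exact: mindic.
  - move=> x _; rewrite (sumE A (fun i => f i x)) // (sumE B (fun i => f i (a (s i) x))) //.
    rewrite -EFinD lee_fin natr1 ler_nat.
    under eq_bigr do rewrite countA; under [leqRHS]eq_bigr do rewrite countA.
    exact: fflow.
move: le_int; rewrite ge0_integralD //; last exact: mindic.
rewrite !intE // integral_cst // mul1e.
rewrite [X in (_ + X <= _)%E](_ : _ = 1%E); last exact: probability_setT.
under eq_bigr do rewrite AB.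
have : (\sum_p mu (A p) \is a fin_num)%E.
  apply/sum_fin_numP => p _ _.
  by rewrite /= ge0_fin_numE // (le_lt_trans (probability_le1 mu (mA p))) ?ltry.
case: (\sum_p mu (A p))%E => // r _; rewrite -EFinD lee_fin; lra.
Qed.

(** * The factor map read off a joint orbit closure *)

Section joint_orbit.
Context (G : groupType) (S : finType) (Z : topologicalType) (a : gaction G Z).
Hypotheses (Zh : hausdorff_space Z) (Zc : compact [set: Z])
  (Zmin : forall z, dense (gorbit a z)).
Context (E : block_system a) (x : full_shift G S) (z0 : Z).

(** This becomes the graph of the factor map once the first coordinate determines the second. *)
Definition joint_orbit : set (full_shift G S * Z) :=
  closure [set (Defs.shift g x, a g z0) | g in [set: G]].

Lemma joint_orbit_near y z (P : full_shift G S -> Prop) n :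
  joint_orbit (y, z) -> (\forall y' \near y, P y') ->
  exists g, P (Defs.shift g x) /\ E n z (a g z0).
Proof.
move=> yz yP; have [|_ [[g _ <-] [/= Pg Eg]]] := yz ([set y' | P y'] `*` [set z' | E n z z']).
  by exists ([set y' | P y'], [set z' | E n z z']) => //; split => //; exact: block_near.
by exists g.
Qed.

Lemma joint_orbit_act g y z : joint_orbit (y, z) ->
  joint_orbit (Defs.shift g y, a g z).
Proof.
move=> yz B [[B1 B2] [/= /(@Defs.shift_continuous G S g) B1y /(act_continuous (g := g)) B2z] B12].
have [|_ [[h _ <-] [/= Bh1 Bh2]]] := yz ((Defs.shift g @^-1` B1) `*` (a g @^-1` B2)).
  by exists (Defs.shift g @^-1` B1, a g @^-1` B2).
exists (Defs.shift (g * h)%g x, a (g * h)%g z0); split; first by exists (g * h)%g.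
by apply: B12; rewrite shiftM act_mul.
Qed.

Lemma joint_orbit_fst_closed : closed [set y | exists z, joint_orbit (y, z)].
Proof.
have cJ : compact joint_orbit.
  apply: (subclosed_compact (@closed_closure _ _) _ (@subsetT _ _)).
  by rewrite -setXTT; exact: compact_setX (@full_shift_compact G S) Zc.
rewrite (_ : [set y | _] = fst @` joint_orbit).
  apply: compact_closed; first exact: full_shift_hausdorff.
  apply: continuous_compact cJ; apply: continuous_subspaceT => -[y z]; exact: cvg_fst.
by apply/seteqP; split => [y [z yz]|_ [[y z] yz <-]]; [exists (y, z) | exists z].
Qed.

Lemma joint_orbit_snd_closed : closed [set z | exists y, joint_orbit (y, z)].
Proof.
have cJ : compact joint_orbit.
  apply: (subclosed_compact (@closed_closure _ _) _ (@subsetT _ _)).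
  by rewrite -setXTT; exact: compact_setX (@full_shift_compact G S) Zc.
rewrite (_ : [set z | _] = snd @` joint_orbit).
  apply: compact_closed => //.
  apply: continuous_compact cJ; apply: continuous_subspaceT => -[y z]; exact: cvg_snd.
by apply/seteqP; split => [z [y yz]|_ [[y z] yz <-]]; [exists (y, z) | exists y].
Qed.

Lemma joint_orbit_orbit g : joint_orbit (Defs.shift g x, a g z0).
Proof. by apply: subset_closure; exists g. Qed.

Lemma joint_orbit_fst y : points (orbit_closure x) y -> exists z, joint_orbit (y, z).
Proof.
have := joint_orbit_fst_closed; rewrite closure_id => cl xy.
suff : [set y | exists z, joint_orbit (y, z)] y by [].
rewrite cl; apply: closureS xy => _ [g _ <-].
by exists (a g z0); exact: joint_orbit_orbit.
Qed.

Lemma joint_orbit_snd z : exists y, joint_orbit (y, z).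
Proof.
have := joint_orbit_snd_closed; rewrite closure_id => cl.
suff : [set z | exists y, joint_orbit (y, z)] z by [].
rewrite cl => B Bz; have [_ [/[swap] -[g _ <-] /interior_subset Bg]] :=
  Zmin z0 (ex_intro _ z (Bz : B° z)) (open_interior B).
exists (a g z0); split => //; exists (Defs.shift g x); exact: joint_orbit_orbit.
Qed.

Lemma joint_orbit_points y z : joint_orbit (y, z) -> points (orbit_closure x) y.
Proof.
move=> yz B By; have [g [Bg _]] := joint_orbit_near 0 yz By.
by exists (Defs.shift g x); split => //; exists g.
Qed.

Hypothesis x_toeplitz : forall g, exists n, forall h,
  E n (a h z0) z0 -> x (h * g)%g = x g.
Hypothesis x_separates : forall y z z',
  joint_orbit (y, z) -> joint_orbit (y, z') -> z = z'.

(** [x_separates] makes the joint orbit closure a graph, and a closed graph into a compact space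
    gives continuity. If [y] lies over [z0], its value at [k] is that of a shift of [x] by an
    element returning [z0] close to itself, hence is [x k] by [x_toeplitz]; so the fibres over the
    dense orbit of [z0] are singletons. *)
Lemma exists_almost_one_to_one_factor :
  exists p : set_type (orbit_closure x : set _) -> Z,
    factor_map (subshift_action (orbit_closure x)) a p /\ almost_one_to_one p.
Proof.
have /choice[p pP] : forall y : set_type (orbit_closure x : set _),
    exists z, joint_orbit (set_val y, z).
  by move=> y; apply: joint_orbit_fst; exact: set_valP.
have pE y z : joint_orbit (set_val y, z) -> p y = z by exact: x_separates (pP y).
have pact g y : p (sub_shift g y) = a g (p y).
  by apply: pE; exact: joint_orbit_act (pP y).
have fib (y : set_type (orbit_closure x : set _)) : p y = z0 -> set_val y = x.
  move=> py; apply/funext => k; have [n nP] := x_toeplitz k.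
  have := pP y; rewrite py => yz0.
  have [h [/= <- hE]] := joint_orbit_near n yz0 (near_value _ k).
  apply: nP; have := block_act h^-1%g hE.
  by rewrite -act_mul mulVg act_one.
pose x' : set_type (orbit_closure x : set _) :=
  exist _ x (mem_set (@orbit_closure_self G S x)).
have px' : p x' = z0.
  by apply: pE; have := @joint_orbit_orbit 1%g; rewrite shift1 act_one.
have fibg g (y : set_type (orbit_closure x : set _)) :
    p y = a g z0 -> y = sub_shift g x'.
  move=> py; have /fib yx : p (sub_shift g^-1%g y) = z0.
    by rewrite pact py -act_mul mulVg act_one.
  transitivity (sub_shift g (sub_shift g^-1%g y)).
    by rewrite -sub_shiftM mulgV sub_shift1.
  by congr (sub_shift g _); exact: val_inj.
exists p; split; first split => //.
- move=> y U pU.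
  have cU : compact (~` U°).
    by apply: (subclosed_compact _ Zc) => //; apply: open_closedC; exact: open_interior.
  have /compact_near_coveringP cov := cU.
  have nearK : \forall y' \near (set_val y : full_shift G S),
      ~` U° `<=` [set z | ~ joint_orbit (y', z)].
    apply: (cov _ _ (fun y' z => ~ joint_orbit (y', z)) (nbhs_filter _)) => z nUz.
    have : nbhs (set_val y, z) (~` joint_orbit).
      apply: open_nbhs_nbhs; split; first exact/closed_openC/closed_closure.
      by move=> /pE pz; apply: nUz; rewrite -pz.
    move=> [[B1 B2] [/= B1y B2z] B12]; exists (B2, B1) => //= -[z' y'] /= [? ?].
    by apply: B12.
 apply: (@filterS _ (nbhs y) _ _ _ _ (@set_val_continuous _ _ y _ nearK)) => y' y'K.
  apply: contrapT => nU; apply: (y'K (p y')) (pP y').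
  by move=> /interior_subset.
- move=> z; have [y yz] := joint_orbit_snd z.
  exists (exist _ y (mem_set (joint_orbit_points yz))); exact: pE.
- move=> V [v Vv] oV; have [_ [/[swap] -[g _ <-] Vg]] := Zmin z0 (ex_intro _ v Vv) oV.
  exists (a g z0); split => //; exists (sub_shift g x').
  by apply/seteqP; split => [y /fibg|_ ->]; last rewrite /= pact px'.
Qed.

End joint_orbit.

(** * Extensions without invariant measures *)

Lemma nonamenable_symbolic_extension (R : realType) (G : groupType)
    (Z : topologicalType) (a : gaction G Z) (z0 : Z) :
  countable [set: G] -> ~ amenable G R ->
  hausdorff_space Z -> compact [set: Z] -> isolated [set: Z] = set0 ->
  (forall z, dense (gorbit a z)) -> block_system a ->
  (forall g, a g z0 = z0 -> g = 1%g) ->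
  exists (S : finType) (x : full_shift G S)
    (p : set_type (orbit_closure x : set _) -> Z),
    [/\ (1 < #|S|)%N, factor_map (subshift_action (orbit_closure x)) a p,
        almost_one_to_one p
      & ~ has_invariant_probability R (subshift_action (orbit_closure x))].
Proof.
move=> cG nG Zh Zc Zperf Zmin E0 free.
have [z1 z1P] := exists_off_orbit Zh Zc Zperf E0 z0 cG.
have [E annuli] := block_subsequence Zh Zperf E0 z1.
(* The return times of [z0] to its block form a subgroup because blocks are permuted; freeness makes
   their intersection trivial. *)
pose Gam n := [set h | E n (a h z0) z0].
have Gsg n : subgroup (Gam n).
  split; first by apply/mem_set; rewrite /Gam /= act_one; exact: block_refl.
  move=> g h /set_mem Gg /set_mem Gh; apply/mem_set; rewrite /Gam /= act_mul.
  apply: block_trans (block_act g _) Gg.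
  have := block_act h^-1%g (block_sym Gh).
  by rewrite -act_mul mulVg act_one.
have G1 g : (forall n, Gam n g) -> g = 1%g.
  move=> Gg; apply: free; apply: contrapT => /(block_separates Zh E)[n]; apply.
  exact: Gg.
have Gdec m n : (m <= n)%N -> Gam n `<=` Gam m by move=> mn g; exact: block_le.
have [I [s [J [x [xflow xper]]]]] := toeplitz_nat_flow nG cG Gsg G1 Gdec.
pose S := ({ffun I -> 'I_J.+1} * bool)%type.
pose par := annulus_parity E z1.
(* The inverse matches the shift: coordinate [g] of the shift of [xi] by [h] carries the parity at
   [g^-1 * h] applied to [z0]. *)
pose xi : full_shift G S := fun g => ([ffun i => x i g], par (a g^-1%g z0)).
(* The parity is locally constant at every point of the orbit of [z0], which avoids [z1]. *)
have xi_toeplitz g : exists n, forall h, E n (a h z0) z0 -> xi (h * g)%g = xi g.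
  have [n nP] := xper g.
  have [k kz] := exists_annulus Zh E (z1P g^-1%g).
  exists (maxn n k.+1) => h hE; rewrite /xi; congr (_, _).
    by apply/ffunP => i; rewrite !ffunE nP //; apply: block_le (leq_maxl _ _) hE.
  rewrite /par (annulus_parityE kz); apply: annulus_parityE.
  apply: (annulus_block (ltnSn k) kz).
  rewrite invgM act_mul; apply: block_act.
  have := block_act h^-1%g (block_le (leq_maxr _ _) hE).
  by rewrite -act_mul mulVg act_one.
have xi_par y z g : joint_orbit a xi z0 (y, z) -> a g z <> z1 ->
    (y g^-1%g).2 = par (a g z).
  move=> yz /(exists_annulus Zh E)[k kz].
  have [h [<- hE]] := joint_orbit_near E k.+1 yz (near_value _ g^-1%g).
  rewrite /Defs.shift /xi /= -invgM invgK act_mul /par (annulus_parityE kz).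
  by apply/annulus_parityE/(annulus_block (ltnSn k) kz)/block_act.
have xi_sep y z z' : joint_orbit a xi z0 (y, z) -> joint_orbit a xi z0 (y, z') -> z = z'.
  move=> yz yz'; apply: contrapT.
  move=> /(annulus_parity_separates Zh Zc Zmin annuli)[g [gz gz' ne]].
  by apply: ne; rewrite -/(par _) -(xi_par _ _ _ yz gz) (xi_par _ _ _ yz' gz').
have [p [pfac palm]] := exists_almost_one_to_one_factor Zh Zc Zmin xi_toeplitz xi_sep.
exists S, xi, p; split => //.
  rewrite card_prod card_bool card_ffun card_ord.
  have : (0 < J.+1 ^ #|I|)%N by rewrite expn_gt0.
  by case: (J.+1 ^ #|I|)%N => // n _; rewrite mulSn.
pose f i (y : set_type (orbit_closure xi : set _)) : nat := (set_val y 1%g).1 i.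
(* Acting by [(s i)^-1] brings the coordinate [s i] to the coordinate 1, where [f i] is read. *)
apply: (@no_invariant_probability R G _ _ I (fun i => (s i)^-1%g) J f).
- by move=> i y; rewrite -ltnS ltn_ord.
- move=> i y; apply: (@filterS _ (nbhs y) _ _ _ _
    (@set_val_continuous _ _ y _ (near_value (set_val y) 1%g))) => y' /= e.
  by rewrite /f e.
- move=> y.
  (* The inequality involves finitely many coordinates, on which [y] agrees with some shift of
     [xi]. *)
  have : \forall y' \near (set_val y : full_shift G S),
      (forall i, y' (s i) = set_val y (s i)) /\ y' 1%g = set_val y 1%g.
    apply: filterI; last exact: near_value.
    apply: (@filter_forall _ I (fun i (y' : full_shift G S) => y' (s i) = set_val y (s i))
      (nbhs (set_val y : full_shift G S)) (nbhs_filter _)) => i.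
    exact: near_value.
  move=> /(closure_orbit_near (set_valP y))[g [gs g1]].
  have fE i : f i (sub_shift (s i)^-1%g y) = x i (g^-1 * s i)%g.
    rewrite -[LHS]/(nat_of_ord ((set_val y ((s i)^-1^-1 * 1)%g).1 i)).
    by rewrite invgK mulg1 -gs /Defs.shift ffunE.
  have f1 i : f i y = x i g^-1%g by rewrite /f -g1 /Defs.shift mulg1 ffunE.
  under eq_bigr do rewrite fE; under [ltnRHS]eq_bigr do rewrite f1.
  exact: xflow.
Qed.

(** * Odometers *)

Section coded_metric.
Context (R : realType) (T : choiceType) (C : Type) (f : nat -> T -> C).

(* The value is $1/(n+1)$ with $n$ the first index at which the codes differ;
   the supremum of the empty set is $0$. *)
Definition code_dist (x y : T) : R := sup [set n.+1%:R^-1 | n in [set n | f n x <> f n y]].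

Lemma code_dist_ub x y n : f n x <> f n y -> n.+1%:R^-1 <= code_dist x y.
Proof.
move=> ne; apply: ub_le_sup; last by exists n.
by exists 1 => _ [m _ <-]; rewrite invf_le1 // ler1n.
Qed.

Lemma code_dist_le x y e : 0 <= e ->
  (forall n, f n x <> f n y -> n.+1%:R^-1 <= e) -> code_dist x y <= e.
Proof.
move=> e0 ne; rewrite /code_dist; set S := [set _ | _ in _].
have [->|/set0P S0] := eqVneq S set0; first by rewrite sup0.
by apply: ge_sup => // _ [n nxy <-]; exact: ne.
Qed.

Lemma code_dist_lt x y n : code_dist x y < n.+1%:R^-1 ->
  forall i, (i <= n)%N -> f i x = f i y.
Proof.
move=> lt i le; apply: contrapT => /code_dist_ub; apply/negP; rewrite -ltNge.
by apply: lt_le_trans lt _; rewrite lef_pV2 ?posrE // ler_nat.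
Qed.

Lemma code_dist_ge0 x y : 0 <= code_dist x y.
Proof.
have [e|/existsNP[n ne]] := pselect (forall n, f n x = f n y).
  rewrite /code_dist (_ : [set _ | _ in _] = set0) ?sup0 //.
  by apply/seteqP; split => // r [n /= ne _]; case: (ne (e n)).
by apply: le_trans (code_dist_ub ne).
Qed.

Lemma code_dist_xx x : code_dist x x = 0.
Proof. by apply/eqP; rewrite eq_le code_dist_ge0 andbT code_dist_le // => n; case. Qed.

Lemma code_dist_sym x y : code_dist x y = code_dist y x.
Proof.
by congr sup; apply/seteqP; split => _ [n ne <-]; exists n => //; exact: nesym.
Qed.

Lemma code_dist_triangle y x z : code_dist x z <= code_dist x y + code_dist y z.
Proof.
apply: code_dist_le => [|n xz]; first by rewrite addr_ge0 // code_dist_ge0.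
have [xy|xy] := pselect (f n x = f n y).
  by rewrite ler_wpDl ?code_dist_ge0 // code_dist_ub // -xy.
by rewrite ler_wpDr ?code_dist_ge0 // code_dist_ub.
Qed.

Hypothesis f_sep : forall x y, (forall n, f n x = f n y) -> x = y.

Lemma code_dist_positivity x y : code_dist x y = 0 -> x = y.
Proof.
move=> d0; apply: f_sep => n; apply: contrapT => /code_dist_ub.
by rewrite d0 leNgt invr_gt0 ltr0n.
Qed.

End coded_metric.

(** A copy of [T] whose type records [f] and [f_sep], from which the metric is built. *)
Definition coded (R : realType) (T : choiceType) (C : Type) (f : nat -> T -> C)
    (f_sep : forall x y, (forall n, f n x = f n y) -> x = y) : Type := T.

Section coded_topology.
Context (R : realType) (T : choiceType) (C : Type) (f : nat -> T -> C).
Hypothesis f_sep : forall x y, (forall n, f n x = f n y) -> x = y.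

HB.instance Definition _ := Choice.on (coded R f_sep).
HB.instance Definition _ := @isMetric.Build R (coded R f_sep)
  (code_dist R f) (code_dist_xx R f) (code_dist_positivity f_sep)
  (code_dist_sym R f) (code_dist_triangle R f).

Lemma coded_nbhsP (x : coded R f_sep) (U : set (coded R f_sep)) : nbhs x U <->
  exists n, forall y, (forall i, (i < n)%N -> f i x = f i y) -> U y.
Proof.
split=> [/nbhs_ballP[e /= e0 eU]|[n nU]].
  exists (Num.truncn e^-1).+1 => y xy; apply: eU; rewrite ballEmdist /=.
  apply: (@le_lt_trans _ _ (Num.truncn e^-1).+2%:R^-1).
    apply: code_dist_le => // i ne; rewrite lef_pV2 ?posrE // ler_nat ltnS ltnNge.
    by apply/negP => ile; apply: ne; apply: xy; rewrite ltnS.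
  rewrite invf_plt ?posrE //; apply: lt_trans (truncnS_gt _) _.
  by rewrite ltr_nat.
apply/nbhs_ballP; exists n.+1%:R^-1 => //= y; rewrite ballEmdist /= => xy.
by apply: nU => i /ltnW; exact: code_dist_lt xy _.
Qed.

End coded_topology.

(** Countably many locally constant functions that separate points metrise a compact Hausdorff
    space. This turns subshifts and odometers, built as topological spaces, into systems of type
    [tds]; [h] and [k] are the identity. *)
Lemma metrizable_system (R : realType) (G : groupType) (T : topologicalType)
    (a : gaction G T) (C : Type) (f : nat -> T -> C) :
  hausdorff_space T -> compact [set: T] -> [set: T] !=set0 ->
  (forall n x, \forall y \near x, f n y = f n x) ->
  (forall x y, (forall n, f n x = f n y) -> x = y) ->
  exists (X : tds R G) (h : X -> T) (k : T -> X),
    [/\ continuous h, continuous k, cancel h k, cancel k h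
      & (forall g x, h (tact X g x) = a g (h x)) /\
        (forall x y, mdist x y = code_dist R f (h x) (h y))].
Proof.
move=> Th Tc T0 fnear fsep.
pose X : metricType R := coded R fsep.
have XE (x : T) : nbhs (x : X) = nbhs x.
  apply/seteqP; split => U.
    move=> /coded_nbhsP[n nU]; apply: (@filterS _ (nbhs x) _ _ _ nU).
    elim: n {nU} => [|n IH]; first exact: nearW.
    apply: filterS2 IH (fnear n x) => y xy yn i.
    by rewrite ltnS leq_eqVlt => /predU1P[-> //|]; exact: xy.
  rewrite nbhsE => -[V [oV Vx] VU].
  have cK : compact (~` V).
    by apply: (subclosed_compact _ Tc) => //; exact: open_closedC.
  have /compact_near_coveringP/(_ nat \oo
    (fun n y => exists2 i, (i < n)%N & f i y <> f i x) _) := cK.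
  case=> [y nVy|N _ /(_ N (leqnn N)) KN].
    have [i ne] : exists i, f i y <> f i x.
      apply: contrapT => /forallNP e; apply: nVy; rewrite (fsep y x) // => n.
      by apply: contrapT; exact: e.
    exists ([set y' | f i y' = f i y], [set m | (i < m)%N]).
      by split; [exact: fnear | exact: nbhs_infty_gt].
    by move=> [y' m] /= [e im]; exists i => //; rewrite e.
  apply/coded_nbhsP; exists N => y xy; apply: VU; apply: contrapT => /KN[i iN]; apply.
  by rewrite xy.
have Xc : compact [set: X].
  move=> F FF FT; have [x [_ clx]] := Tc F FF FT.
  by exists x; split => // A B FA; rewrite XE; exact: clx.
have actC g : continuous (a g : X -> X).
  by move=> x U; rewrite XE => /act_continuous; rewrite -(XE x).
pose aX := @GAction G X a (act_one a) (act_mul a) actC.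
exists (@TDS R G X aX T0 Xc), (fun x => x), (fun x => x); split => //.
- by move=> x U /= Ux; have := Ux; rewrite -XE.
- by move=> x U /= Ux; have := Ux; rewrite XE.
Qed.

Section action_restriction.
Context (G : groupType) (X : topologicalType) (a : gaction G X) (K : set X).
Hypothesis aK : forall g x, K x -> K (a g x).

Definition restriction (g : G) (x : set_type K) : set_type K :=
  exist _ (a g (set_val x)) (mem_set (aK g (set_valP x))).

Lemma restriction1 x : restriction 1%g x = x.
Proof. by apply: val_inj; rewrite /= act_one. Qed.

Lemma restrictionM g h x : restriction (g * h)%g x = restriction g (restriction h x).
Proof. by apply: val_inj; rewrite /= act_mul. Qed.

Lemma restriction_continuous g : continuous (restriction g).
Proof.
apply: continuous_comp_initial => x.
apply: (@continuous_comp _ _ _ (set_val : K -> X) (a g)).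
  exact: initial_continuous.
exact: act_continuous.
Qed.

Definition restricted_action : gaction G (set_type K) :=
  GAction restriction1 restrictionM restriction_continuous.

End action_restriction.

Section finite_index.
Context (G : groupType).

Definition lcoset (g : G) (H : set G) : set G := [set (g * h)%g | h in H].

Lemma lcosetE g H x : lcoset g H x <-> H (g^-1 * x)%g.
Proof.
split=> [[h Hh <-]|Hx]; first by rewrite mulKg.
by exists (g^-1 * x)%g => //; rewrite mulVKg.
Qed.

Lemma lcoset_self g H : subgroup H -> lcoset g H g.
Proof. by move=> sH; apply/lcosetE; rewrite mulVg; exact: subgroup1. Qed.

Lemma lcosetM g h H : lcoset (g * h)%g H = lcoset g (lcoset h H).
Proof.
apply/seteqP; split => x /lcosetE Hx; apply/lcosetE; move: Hx.
  by rewrite ?lcosetE invgM mulgA.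
by rewrite ?lcosetE invgM mulgA.
Qed.

Lemma lcoset_eq g h H x : subgroup H -> lcoset g H x -> lcoset h H x ->
  lcoset g H = lcoset h H.
Proof.
move=> sH; suff main k l y : lcoset k H x -> lcoset l H x -> lcoset k H y -> lcoset l H y.
  by move=> gx hx; apply/seteqP; split => y; [exact: main gx hx | exact: main hx gx].
move=> /lcosetE kx /lcosetE lx /lcosetE ky; apply/lcosetE.
rewrite (_ : l^-1 * y = (l^-1 * x) * ((k^-1 * x)^-1 * (k^-1 * y)))%g.
  by apply: subgroupM => //; apply: subgroupM => //; exact: subgroupV.
by rewrite invgM invgK -!mulgA mulVKg mulVKg.
Qed.

Lemma lcoset_id g H : subgroup H -> H g -> lcoset g H = H.
Proof.
move=> sH Hg; apply/seteqP; split => x; rewrite lcosetE => Hx.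
  by rewrite -[x](mulVKg g); exact: subgroupM.
by apply: subgroupM => //; exact: subgroupV.
Qed.

Lemma finite_index_setT : finite_index_subgroup [set: G].
Proof.
split; first by split => [|? ? _ _]; exact/mem_set.
apply: (@sub_finite_set _ _ [set setT]); last exact: finite_set1.
by move=> _ [g _ <-]; apply/seteqP; split => // x _; apply/(lcosetE g).
Qed.

Lemma finite_index_setI (H K : set G) : finite_index_subgroup H ->
  finite_index_subgroup K -> finite_index_subgroup (H `&` K).
Proof.
move=> [sH fH] [sK fK]; split.
  split; first by apply/mem_set; split; exact: subgroup1.
  move=> g h /set_mem[Hg Kg] /set_mem[Hh Kh]; apply/mem_set.
  by split; apply: subgroupM => //; exact: subgroupV.
apply: (@sub_finite_set _ _ [set A.1 `&` A.2 | A in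
  [set lcoset g H | g in [set: G]] `*` [set lcoset g K | g in [set: G]]]); last first.
  by apply: finite_image; exact: finite_setX.
move=> _ [g _ <-]; exists (lcoset g H, lcoset g K); first by split; exists g.
apply/seteqP; split => x /=; first by move=> [/lcosetE ? /lcosetE ?]; apply/(lcosetE g).
by move=> /(lcosetE g)[? ?]; split; apply/lcosetE.
Qed.

(** The conjugate of [H] by [g] is the stabiliser of the coset [g H]; it occurs as such in the
    odometer. *)
Lemma finite_index_conj (H : set G) g : finite_index_subgroup H ->
  finite_index_subgroup [set h | H (g^-1 * h * g)%g].
Proof.
move=> [sH fH]; split.
  split; first by apply/mem_set; rewrite /= mulg1 mulVg; exact: subgroup1.
  move=> h k /set_mem /= Hh /set_mem /= Hk; apply/mem_set => /=.
  rewrite (_ : g^-1 * (h / k) * g = (g^-1 * h * g) * (g^-1 * k * g)^-1)%g.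
    by apply: subgroupM => //; exact: subgroupV.
  by rewrite !invgM invgK !mulgA mulgK.
apply: (@sub_finite_set _ _ [set [set (x * g^-1)%g | x in A] | A in
  [set lcoset k H | k in [set: G]]]); last exact: finite_image.
move=> _ [k _ <-]; exists (lcoset (k * g)%g H); first by exists (k * g)%g.
apply/seteqP; split => [_ [x /lcosetE Hx <-]|x /(lcosetE k) /= Hx].
  by apply/(lcosetE k) => /=; move: Hx; rewrite invgM !mulgA mulgVK.
exists (x * g)%g; last by rewrite mulgK.
by apply/lcosetE; rewrite invgM !mulgA; rewrite !mulgA in Hx.
Qed.

Lemma finite_index_neq1 (H : set G) : infinite_set [set: G] ->
  finite_index_subgroup H -> exists2 h, H h & h != 1%g.
Proof.
move=> infG [sH fH]; apply: contrapT => noh; apply: infG.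
have H1 h : H h -> h = 1%g.
  by move=> Hh; apply: contrapT => /eqP ne; apply: noh; exists h.
have inj : injective (fun g => lcoset g H).
  move=> g h e; have := lcoset_self h sH; rewrite -e => /lcosetE/H1 gh.
  by rewrite -[h](mulVKg g) gh mulg1.
rewrite (_ : setT = (fun g => lcoset g H) @^-1` [set lcoset g H | g in [set: G]]).
  by apply: finite_preimage => // g h _ _; exact: inj.
by apply/seteqP; split => // g _; exists g.
Qed.

(** [Gam n] is the intersection of subgroups that exclude the non-trivial elements of code below
    [n]. *)
Lemma residual_chain : countable [set: G] -> residually_finite G ->
  exists Gam : nat -> set G, [/\ forall n, finite_index_subgroup (Gam n),
    forall m n, (m <= n)%N -> Gam n `<=` Gam m
    & forall g, (forall n, Gam n g) -> g = 1%g].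
Proof.
move=> /countable_injP[code /in2TT codeI] rf.
have /choice[H HP] : forall g : G, exists H, finite_index_subgroup H /\ (g <> 1%g -> ~ H g).
  move=> g; have [->|/rf[H fH nH]] := eqVneq g 1%g; last by exists H.
  by exists setT; split => //; exact: finite_index_setT.
pose Gam n := [set h | forall g, (code g < n)%N -> H g h].
exists Gam; split.
- elim=> [|n IH].
    rewrite (_ : Gam 0%N = setT); first exact: finite_index_setT.
    by apply/seteqP; split.
  have [[g gn]|nog] := pselect (exists g, code g = n).
    rewrite (_ : Gam n.+1 = Gam n `&` H g); first exact: finite_index_setI (HP g).1.
    apply/seteqP; split => [h Gh|h [Gh Hh] k]; first split.
    - by move=> k kn; apply: Gh; exact: ltnW.
    - by apply: Gh; rewrite gn.
    - by rewrite ltnS leq_eqVlt -{1}gn => /predU1P[/codeI ->|/Gh].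
  rewrite (_ : Gam n.+1 = Gam n) //; apply/seteqP; split => h Gh k kn.
    by apply: Gh; exact: ltnW.
  by apply: Gh; move: kn; rewrite ltnS leq_eqVlt => /predU1P[e|//]; case: nog; exists k.
- by move=> m n mn h Gh g gm; apply: Gh; exact: leq_trans mn.
- move=> g Gg; apply: contrapT => g1; apply: ((HP g).2 g1).
  by apply: (Gg (code g).+1).
Qed.

End finite_index.

(** * Inverse limits of finite coset spaces *)

Section odometer.
Context (G : groupType) (Gam : nat -> set G).
Hypotheses (G_infinite : infinite_set [set: G])
  (Gam_fi : forall n, finite_index_subgroup (Gam n))
  (Gam_le : forall m n, (m <= n)%N -> Gam n `<=` Gam m)
  (Gam1 : forall g, (forall n, Gam n g) -> g = 1%g).

Let coset_space : topologicalType :=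
  prod_topology (fun _ : nat => discrete_topology (set G)).

Let translate (g : G) (z : coset_space) : coset_space := fun n => lcoset g (z n).

Let translate1 z : translate 1%g z = z.
Proof.
apply/funext => n; apply/seteqP; split => x; first by move/lcosetE; rewrite invg1 mul1g.
by move=> zx; apply/(lcosetE 1%g); rewrite invg1 mul1g.
Qed.

Let translateM g h z : translate (g * h)%g z = translate g (translate h z).
Proof. by apply/funext => n; exact: lcosetM. Qed.

Let near_coord (z : coset_space) n : \forall z' \near z, z' n = z n.
Proof.
exact: (@proj_continuous nat (fun=> discrete_topology (set G)) n z _ (discrete_set1 _)).
Qed.

Let translate_continuous g : continuous (translate g).
Proof.
apply: (@continuous_prod_topology nat (fun=> discrete_topology (set G))) => n z U zU.
apply: (@filterS _ (nbhs z) _ _ _ _ (near_coord z n)) => z' e.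
by rewrite /translate /= e; exact: nbhs_singleton zU.
Qed.

Let translation := GAction translate1 translateM translate_continuous.

(* The inverse limit of the finite coset spaces [G / Gam n]. *)
Let odometer : set coset_space := [set z | (forall n, exists g, z n = lcoset g (Gam n)) /\
  forall n, z n.+1 `<=` z n].

Let odometer_translate g z : odometer z -> odometer (translation g z).
Proof.
move=> [zc zd]; split => n.
  by have [h zh] := zc n; exists (g * h)%g; rewrite /= /translate zh lcosetM.
by move=> x /lcosetE /zd zx; apply/lcosetE.
Qed.

Let odometer_compact : compact odometer.
Proof.
(* The discrete space of all subsets of [G] is not compact, but the cosets of each [Gam n] are
   finite in number. *)
pose A n : set (discrete_topology (set G)) := [set lcoset g (Gam n) | g in [set: G]].
have cA n : compact (A n) by apply: finite_compact; have [] := Gam_fi n.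
have cP := @tychonoff nat (fun=> discrete_topology (set G)) A cA.
apply: (subclosed_compact _ cP); last first.
  by move=> z [zc _] n; have [g ->] := zc n; exists g.
move=> z clz; split => n.
  have [z' [[zc _] /= <-]] := clz _ (near_coord z n).
  exact: zc.
have [z' [[_ zd] [/= <- <-]]] := clz _ (filterI (near_coord z n) (near_coord z n.+1)).
exact: zd.
Qed.

Let base : coset_space := Gam.

Let odometer_base : odometer base.
Proof.
split => n; last exact: Gam_le.
exists 1%g; apply/seteqP; split => x; last by move/lcosetE; rewrite invg1 mul1g.
by move=> ?; apply/(lcosetE 1%g); rewrite invg1 mul1g.
Qed.

(** A coset of [Gam n] lies in just one coset of [Gam i], so each coordinate determines the earlier
    ones. *)
Let agree_le z z' n : odometer z -> odometer z' -> z n = z' n ->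
  forall i, (i <= n)%N -> z i = z' i.
Proof.
move=> [zc zd] [zc' zd'] e i le; have [g zg] := zc n.
have down (w : coset_space) : (forall n, w n.+1 `<=` w n) -> w n `<=` w i.
  move=> wd; rewrite -(subnKC le); elim: (n - i)%N => [|j IH]; first by rewrite addn0.
  by rewrite addnS => x /wd; exact: IH.
have gz : z n g by rewrite zg; exact: lcoset_self (Gam_fi n).1.
have := down z zd _ gz; have := down z' zd' g; rewrite -e => /(_ gz).
have [h ->] := zc i; have [k ->] := zc' i => ? ?.
by apply: (@lcoset_eq _ _ _ _ g (Gam_fi i).1).
Qed.

(** The last clause will make singleton fibres Toeplitz. It holds because the stabiliser of a coset
    of [Gam n] is a conjugate of [Gam n]. *)
Lemma exists_odometer (R : realType) : exists Z : tds R G,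
  [/\ minimal_tds Z, equicontinuous_tds Z, cantor_system Z, has_free_orbit Z
    & forall (z : Z) U, nbhs z U -> exists2 H, finite_index_subgroup H &
        forall h, H h -> U (tact Z h z)].
Proof.
pose O := set_type odometer.
pose aO := restricted_action odometer_translate.
pose b : O := exist _ base (mem_set odometer_base).
pose f n (z : O) : set G := set_val z n.
have f_near n (z : O) : \forall z' \near z, f n z' = f n z.
  exact: (@set_val_continuous _ _ z _ (near_coord (set_val z) n)).
have f_sep (z z' : O) : (forall n, f n z = f n z') -> z = z'.
  by move=> e; apply: val_inj; apply/funext.
have Oh : hausdorff_space O.
  by apply/hausdorff_set_type/hausdorff_product => n; exact: discrete_hausdorff.
have [Z [h [k [hC kC hK kK [hact hd]]]]] :=
  @metrizable_system R G O aO (set G) f Oh (compact_set_type odometer_compact)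
    (ex_intro _ b I) f_near f_sep.
have fact n g z : f n (h (tact Z g z)) = lcoset g (f n (h z)) by rewrite hact.
have fc n z : exists g, f n z = lcoset g (Gam n) by have [+ _] := set_valP z; exact.
have fle n z z' : f n z = f n z' -> forall i, (i <= n)%N -> f i z = f i z'.
  by apply: agree_le; exact: set_valP.
have basis (z : Z) U : nbhs z U -> exists n, forall z', f n (h z') = f n (h z) -> U z'.
  move=> /nbhs_ballP[e /= e0 eU]; exists (Num.truncn e^-1) => z' zz'; apply: eU.
  rewrite ballEmdist /= hd; apply: (@le_lt_trans _ _ (Num.truncn e^-1).+2%:R^-1).
    apply: code_dist_le => // i ne; rewrite lef_pV2 ?posrE // ler_nat ltnS ltnNge.
    by apply/negP => ile; apply: ne; exact: fle (esym zz') _ ile.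
  rewrite invf_plt ?posrE //; apply: lt_trans (truncnS_gt _) _.
  by rewrite ltr_nat.
have nearf n (z : Z) : \forall z' \near z, f n (h z') = f n (h z).
  exact: hC z _ (f_near n (h z)).
have Zsep (z z' : Z) : (forall n, f n (h z) = f n (h z')) -> z = z'.
  by move=> /f_sep e; rewrite -[z]hK e hK.
have reach (z z' : Z) n : exists g, f n (h (tact Z g z)) = f n (h z').
  have [u zu] := fc n (h z); have [v zv] := fc n (h z').
  by exists (v * u^-1)%g; rewrite fact zu zv -lcosetM mulgVK.
pose zb := k b.
have fzb n : f n (h zb) = Gam n by rewrite /zb kK.
have zb_free g : tact Z g zb = zb -> g = 1%g.
  move=> gz; apply: Gam1 => n; have := fact n g zb; rewrite gz fzb => e.
  by rewrite e; exact: lcoset_self (Gam_fi n).1.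
exists Z; split.
- move=> z V [v Vv] oV; have [n nV] := basis v V (open_nbhs_nbhs (conj oV Vv)).
  have [g zg] := reach z v n; exists (tact Z g z); split; first exact: nV.
  by exists g.
- move=> e e0; exists e => // g z z'; rewrite !hd; apply: le_lt_trans.
  apply: code_dist_le; first exact: code_dist_ge0.
  by move=> n ne; apply: code_dist_ub => e'; apply: ne; rewrite !fact e'.
- split.
    apply: zero_dimension_totally_disconnected => z z' /eqP zz'.
    have [n ne] : exists n, f n (h z) <> f n (h z').
      by apply: contrapT => /forallNP e; apply: zz'; apply: Zsep => n; apply: contrapT; exact: e.
    exists [set y | f n (h y) = f n (h z)]; split => //; last exact: nesym.
    split; first by rewrite openE => y <-; exact: nearf.
    rewrite -[X in closed X]setCK; apply: open_closedC; rewrite openE => y ny.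
    by apply: filterS (nearf n y) => y' /= ->.
  apply/seteqP; split => // z [_ [V zV]]; rewrite setIT => Vz.
  have [n nV] := basis z V zV; have [g zg] := reach zb z n.
  (* A non-trivial element of [Gam n] keeps the [n]-th coordinate of [zb] but moves [zb], whose
     orbit is free. *)
  have [c Gc /eqP c1] := finite_index_neq1 G_infinite (Gam_fi n).
  have Vg : V (tact Z g zb) by exact: nV.
  have Vgc : V (tact Z (g * c)%g zb).
    by apply: nV; rewrite -zg act_mul !fact fzb (lcoset_id (Gam_fi n).1 Gc).
  rewrite Vz /= in Vg Vgc; apply: c1; apply: zb_free.
  have := act_mul (tact Z) g^-1%g (g * c)%g zb; rewrite mulKg => ->.
  by rewrite Vgc -Vg -act_mul mulVg act_one.
- by exists zb.
- move=> z U zU; have [n nU] := basis z U zU; have [g zg] := fc n (h z).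
  exists [set x | Gam n (g^-1 * x * g)%g]; first exact: finite_index_conj.
  move=> x /= Gx; apply: nU; rewrite fact zg -lcosetM.
  apply: (@lcoset_eq _ _ _ _ (x * g)%g (Gam_fi n).1).
    exact: lcoset_self (Gam_fi n).1.
  by apply/lcosetE; rewrite mulgA.
Qed.

End odometer.

(** * Almost one-to-one extensions *)

(** Upper semicontinuity of fibres: the image of the complement of the interior of [U] is closed and
    misses [z]. *)
Lemma near_singleton_fiber (X Z : topologicalType) (p : X -> Z) (x : X) (z : Z) U :
  hausdorff_space Z -> compact [set: X] -> continuous p ->
  p @^-1` [set z] = [set x] -> nbhs x U ->
  \forall z' \near z, forall x', p x' = z' -> U x'.
Proof.
move=> Zh Xc pC pz xU.
have clK : closed (p @` ~` U°).
  apply: compact_closed => //; apply: continuous_compact; first exact: continuous_subspaceT.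
  by apply: (subclosed_compact _ Xc) => //; apply: open_closedC; exact: open_interior.
have : nbhs z (~` (p @` ~` U°)).
  apply: open_nbhs_nbhs; split; first exact: closed_openC.
  move=> [x' nUx' px']; apply: nUx'.
  by have : (p @^-1` [set z]) x' by []; rewrite pz => ->.
apply: filterS => z' nK x' px'; apply: contrapT => nU; apply: nK.
by exists x' => // /interior_subset.
Qed.

Section maximal_equicontinuous_factor.
Context (R : realType) (G : groupType) (X Z : tds R G) (p : X -> Z).

(* Points of one fibre are moved together into a small neighbourhood of a
   singleton fibre, so an equicontinuous factor cannot tell them apart. *)
Lemma almost_one_to_one_max_equicontinuous : minimal_tds Z -> equicontinuous_tds Z ->
  factor_map (tact X) (tact Z) p -> almost_one_to_one p ->
  max_equicontinuous_factor p.
Proof.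
move=> Zmin Zeq pf palm; split => // W q Weq [qC qS qE].
have [pC pS pE] := pf.
have [z1 _] := @phase_neq0 R G Z.
have [z0 [_ [x0 pz0]]] := palm setT (ex_intro _ z1 I) openT.
have fib x x' : p x = p x' -> q x = q x'.
  move=> pxx'; apply: mdist_positivity; apply/eqP; rewrite eq_le mdist_ge0 andbT.
  apply/ler_addgt0Pl => e e0; rewrite addr0.
  have [d d0 dW] := Weq _ e0.
  have d20 : 0 < d / 2 by rewrite divr_gt0.
  have : nbhs z0 [set z' | forall x', p x' = z' -> ball (q x0) (d / 2) (q x')] :=
    near_singleton_fiber (@metric_hausdorff R Z) (@phase_compact R G X) pC pz0
    (qC x0 _ (nbhsx_ballx (q x0) _ d20)).
  rewrite nbhsE => -[V [oV Vz0] Vq].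
  have [_ [/[swap] -[g _ <-] Vg]] := Zmin (p x) V (ex_intro _ z0 Vz0) oV.
  have qx : ball (q x0) (d / 2) (q (tact X g x)) by apply: (Vq _ Vg); rewrite pE.
  have qx' : ball (q x0) (d / 2) (q (tact X g x')).
    by apply: (Vq _ Vg); rewrite pE pxx'.
  have lt : mdist (q (tact X g x)) (q (tact X g x')) < d.
    by have := ball_splitr qx qx'; rewrite ballEmdist.
  have := dW g^-1%g _ _ lt; rewrite !qE -!act_mul mulVg !act_one.
  exact: ltW.
have /choice[s sP] := pS.
pose r z := q (s z).
have qr : q = r \o p by apply/funext => x /=; apply: fib; rewrite sP.
exists r => //; split.
- apply/continuousP => U oU; rewrite -[X in open X]setCK; apply: closed_openC.
  rewrite (_ : ~` (r @^-1` U) = p @` (q @^-1` ~` U)).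
    apply: compact_closed; first exact: metric_hausdorff.
    apply: continuous_compact; first exact: continuous_subspaceT.
    apply: (subclosed_compact _ (@phase_compact R G X)) => //.
    by apply: closed_comp; [move=> ? _; exact: qC | exact: open_closedC].
  apply/seteqP; split => [z nUz|_ [x nUx <-]]; first by exists (s z).
  by rewrite /= -[r (p x)]/((r \o p) x) -qr.
- by move=> w; have [x <-] := qS w; exists (p x); rewrite qr.
- move=> g z; have [x <-] := pS z.
  by rewrite -pE -[LHS]/((r \o p) _) -[r (p x)]/((r \o p) _) -qr qE.
Qed.

End maximal_equicontinuous_factor.

(** Push-forward; it serves for conjugacies and for the inclusion of a subsystem. *)
Lemma invariant_probability_image (R : realType) (G : groupType)
    (X Y : topologicalType) (a : gaction G X) (b : gaction G Y) (f : X -> Y) :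
  continuous f -> (forall g x, f (a g x) = b g (f x)) ->
  has_invariant_probability R a -> has_invariant_probability R b.
Proof.
move=> fC fE [x0 [mu inv]].
pose F : borel x0 -> borel (f x0) := f.
have mF (B : set (borel (f x0))) : measurable B -> measurable (F @^-1` B).
  have : measurable_fun setT F.
    apply: (@measurability _ _ (borel x0) (borel (f x0)) setT F (@open Y)) => //.
    move=> _ [U oU <-]; rewrite setTI; apply: sub_sigma_algebra.
    by apply: open_comp => // x _; exact: fC.
  by move=> mf mB; rewrite -[X in measurable X]setTI; exact: mf.
pose nu (B : set (borel (f x0))) : \bar R := mu (F @^-1` B).
have nu0 : nu set0 = 0%E by rewrite /nu preimage_set0 measure0.
have nu_ge0 B : (0 <= nu B)%E by exact: measure_ge0.
have nu_add : semi_sigma_additive nu.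
  move=> B mB tB mU; rewrite /nu preimage_bigcup; apply: measure_semi_sigma_additive.
  - by move=> n; exact: mF.
  - by apply/trivIsetP => i j _ _ ij; rewrite -preimage_setI (trivIsetP.1 tB) // preimage_set0.
  - by rewrite -preimage_bigcup; exact: mF.
pose nu_m := isMeasure.Build _ (borel (f x0)) R nu nu0 nu_ge0 nu_add.
pose nu' : {measure set (borel (f x0)) -> \bar R} := HB.pack nu nu_m.
have nuT : nu' setT = 1%E by rewrite /= /nu preimage_setT; exact: probability_setT.
pose nu_p := Measure_isProbability.Build _ (borel (f x0)) R nu' nuT.
pose P : probability (borel (f x0)) R := HB.pack nu nu_m nu_p.
exists (f x0), P => g B mB; rewrite /= /nu.
rewrite (_ : F @^-1` (b g @^-1` B) = a g @^-1` (F @^-1` B)).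
  by apply: inv; exact: mF.
by apply/seteqP; split => x /=; rewrite /F fE.
Qed.

Lemma subshift_metrizable (R : realType) (G : groupType) (S : finType)
    (X : subshift G S) : countable [set: G] -> (X : set _) !=set0 ->
  exists (X' : tds R G) (h : X' -> set_type X) (k : set_type X -> X'),
    [/\ continuous h, continuous k, cancel h k, cancel k h
      & forall g x, h (tact X' g x) = subshift_action X g (h x)].
Proof.
move=> /countable_injP[code /in2TT codeI] [x Xx].
pose e n := xget 1%g [set g | code g = n].
have eK g : e (code g) = g.
  by apply: codeI; exact: (@xgetPex _ 1%g [set h | code h = code g] (ex_intro _ g erefl)).
pose f n (y : set_type X) : S := set_val y (e n).
have [||X' [h [k [hC kC hK kK [hE _]]]]] := @metrizable_system R G _ (subshift_action X) S f
    (@subshift_hausdorff _ _ X) (@subshift_compact _ _ X) (ex_intro _ (exist _ x (mem_set Xx)) I).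
- by move=> n y; exact: (@set_val_continuous _ _ y _ (near_value (set_val y) (e n))).
- by move=> y z yz; apply: val_inj; apply/funext => g; have := yz (code g); rewrite /f eK.
by exists X', h, k.
Qed.

Lemma cantor_system_extension (R : realType) (G : groupType) (Z : tds R G) :
  countable [set: G] -> ~ amenable G R -> minimal_tds Z -> equicontinuous_tds Z ->
  cantor_system Z -> has_free_orbit Z ->
  exists (S : finType) (x : full_shift G S)
    (p : set_type (orbit_closure x : set _) -> Z),
    [/\ (1 < #|S|)%N, factor_map (subshift_action (orbit_closure x)) (tact Z) p,
        almost_one_to_one p
      & ~ has_invariant_probability R (subshift_action (orbit_closure x))].
Proof.
move=> cG nG Zmin Zeq [Ztd Zperf] [z0 free].
have [E] := equicontinuous_block_system Zeq Ztd.
exact: nonamenable_symbolic_extension cG nG (@metric_hausdorff R Z)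
  (@phase_compact R G Z) Zperf Zmin E free.
Qed.

(** The hypothesis speaks of metric systems, so it is applied to a metric copy of the symbolic
    extension, and the measure is carried back by the conjugacy. *)
Lemma amenable_of_almost_automorphic (R : realType) (G : groupType) (Z : tds R G) :
  countable [set: G] -> minimal_tds Z -> equicontinuous_tds Z -> cantor_system Z ->
  has_free_orbit Z ->
  (forall (X : tds R G) (p : X -> Z), factor_map (tact X) (tact Z) p ->
    almost_one_to_one p -> has_invariant_probability R (tact X)) ->
  amenable G R.
Proof.
move=> cG Zmin Zeq Zcan Zfree inv; apply: contrapT => nG.
have [S [x [p [_ [pC pS pE] palm ninv]]]] :=
  cantor_system_extension cG nG Zmin Zeq Zcan Zfree.
have [X [h [k [hC kC hK kK hE]]]] :=
  subshift_metrizable R (X := orbit_closure x) cG (ex_intro _ x (@orbit_closure_self G S x)).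
apply: ninv; apply: (invariant_probability_image hC hE); apply: (inv X (p \o h)).
- split; first by move=> y; apply: continuous_comp; [exact: hC | exact: pC].
    by move=> z; have [y <-] := pS z; exists (k y); rewrite /= kK.
  by move=> g y; rewrite /= hE pE.
- move=> V V0 oV; have [z [Vz [y py]]] := palm V V0 oV.
  exists z; split => //; exists (k y); apply/seteqP; split => [w pw|_ ->] /=.
    have : (p @^-1` [set z]) (h w) by [].
    by rewrite py => /= <-; rewrite hK.
  by rewrite kK; have : (p @^-1` [set z]) y by rewrite py.
Qed.

Section toeplitz_fiber.
Context (R : realType) (G : groupType) (Z : tds R G) (S : finType) (X : subshift G S)
  (p : set_type X -> Z).
Hypotheses (pf : factor_map (subshift_action X) (tact Z) p)
  (Zstab : forall (z : Z) U, nbhs z U -> exists2 H, finite_index_subgroup H &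
    forall h, H h -> U (tact Z h z)).

(** Near [z] all fibres show the same letter at [g], and a finite index subgroup keeps [z] in that
    neighbourhood. *)
Lemma singleton_fiber_toeplitz (x : set_type X) z : p @^-1` [set z] = [set x] ->
  toeplitz (set_val x).
Proof.
move=> pz g; have [pC _ pE] := pf.
have px : p x = z by have : (p @^-1` [set z]) x by rewrite pz.
have /Zstab[H fH HP] := near_singleton_fiber (@metric_hausdorff R Z)
  (@subshift_compact _ _ X) pC pz (@set_val_continuous _ _ x _ (near_value (set_val x) g)).
exists H => // h Hh; have /(_ (subshift_action X h x)) := HP h Hh.
by rewrite pE px => /(_ erefl) /= <-.
Qed.

Lemma orbit_closure_sub (x : full_shift G S) : points X x ->
  points (orbit_closure x) `<=` points X.
Proof.
move=> Xx; rewrite [X in _ `<=` X](closure_id _).1; last exact: subshift_closed.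
by apply: closureS => _ [g _ <-]; exact: subshift_invariant.
Qed.

End toeplitz_fiber.

(** [X] contains the orbit closure of a Toeplitz point, from which a measure is pushed forward by
    inclusion. *)
Lemma toeplitz_extension_invariant (R : realType) (G : groupType) (Z : tds R G)
    (S : finType) (X : subshift G S) (p : set_type X -> Z) :
  (forall (z : Z) U, nbhs z U -> exists2 H, finite_index_subgroup H &
    forall h, H h -> U (tact Z h z)) ->
  factor_map (subshift_action X) (tact Z) p -> almost_one_to_one p ->
  (forall Y : subshift G S, toeplitz_subshift Y ->
    has_invariant_probability R (subshift_action Y)) ->
  has_invariant_probability R (subshift_action X).
Proof.
move=> Zstab pf palm inv; have [z1 _] := @phase_neq0 R G Z.
have [z [_ [x pz]]] := palm setT (ex_intro _ z1 I) openT.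
have xt := singleton_fiber_toeplitz pf Zstab pz.
have sub := @orbit_closure_sub G S X (set_val x) (set_valP x).
pose i (y : set_type (orbit_closure (set_val x) : set _)) : set_type X :=
  exist _ (set_val y) (mem_set (sub _ (set_valP y))).
apply: (@invariant_probability_image R G _ _ (subshift_action (orbit_closure (set_val x)))
  _ i); last by apply: inv; exists (set_val x).
- by apply: continuous_comp_initial; exact: set_val_continuous.
- by move=> g y; exact: val_inj.
Qed.

(** * The equivalences *)

Theorem corollary3 (R : realType) (G : groupType)
    (G_countable : countable [set: G]) (G_infinite : infinite_set [set: G])
    (G_rf : residually_finite G) :
  [<->
    (* (1) *)
    amenable G R;
    (* (2) *)
    forall X : tds R G,
      almost_automorphic X -> has_invariant_probability R (tact X);
    (* (3) *)
    forall (X Y : tds R G) (p : X -> Y),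
      almost_automorphic X -> max_equicontinuous_factor p -> cantor_system Y ->
      has_invariant_probability R (tact X);
    (* (4) *)
    forall (S : finType) (S_ge2 : (1 < #|S|)%N) (X : subshift G S),
      toeplitz_subshift X -> has_invariant_probability R (subshift_action X);
    (* (5) *)
    exists Z : tds R G,
      [/\ minimal_tds Z, equicontinuous_tds Z, cantor_system Z, has_free_orbit Z
        & forall (S : finType) (S_ge2 : (1 < #|S|)%N) (X : subshift G S)
            (p : set_type X -> Z),
            factor_map (subshift_action X) (tact Z) p -> almost_one_to_one p ->
            has_invariant_probability R (subshift_action X)]].
Proof.
have [Gam [Gam_fi Gam_le Gam1]] := residual_chain G_countable G_rf.
have [Z [Zmin Zeq Zcan Zfree Zstab]] := exists_odometer G_infinite Gam_fi Gam_le Gam1 R.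
tfae.
- move=> am X _; apply: amenable_invariant_probability am.
  + exact: metric_hausdorff.
  + exact: phase_compact.
  + exact: phase_neq0.
- by move=> inv X Y p Xaa _ _; exact: inv.
(* Condition (3), applied to extensions of the odometer [Z], gives amenability, which then provides
   a measure on [X]. *)
- move=> inv S _ X [x _ Xx]; apply: amenable_invariant_probability.
  + exact: subshift_hausdorff.
  + exact: subshift_compact.
  + have : points X x by rewrite Xx; exact: (@orbit_closure_self G S x).
    by move=> xX; exists (exist _ x (mem_set xX)).
  + apply: (amenable_of_almost_automorphic G_countable Zmin Zeq Zcan Zfree).
    move=> X' p pf palm.
    have pmax := almost_one_to_one_max_equicontinuous Zmin Zeq pf palm.
    by apply: (inv X' Z p) => //; exists Z, p.
- move=> inv; exists Z; split => // S S2 X p pf palm.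
  by apply: (toeplitz_extension_invariant Zstab pf palm) => Y; exact: inv.
(* The system is given here, not chosen, so the construction has to work over [Z'] and not just over
   the odometer. *)
- move=> [Z' [Z'min Z'eq Z'can Z'free inv]]; apply: contrapT => nG.
  have [S [x [p [S2 pf palm ninv]]]] :=
    cantor_system_extension G_countable nG Z'min Z'eq Z'can Z'free.
  by apply: ninv; exact: inv S2 _ p pf palm.
Qed.
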